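(* For a finite Coxeter group $W$, let $\dim(W)$ denote the order dimension of the weak order on $W$. For the irreducible finite Coxeter groups, named by their types, the following hold: \[\dim(A_n)=n,\qquad \dim(B_n)=n,\qquad \dim(D_n)=n,\] \[6\le\dim(E_6)\le 9,\qquad 7\le\dim(E_7)\le 11,\qquad 8\le\dim(E_8)\le 19,\] \[4\le\dim(F_4)\le 5,\qquad \dim(H_3)=3,\qquad 4\le\dim(H_4)\le 6,\qquad \dim(I_2(m))=2.\]
   Context: The order dimension of a finite poset $P$ is the smallest $d$ such that $P$ embeds as an induced subposet of $\mathbb R^d$ with the componentwise order, i.e. there is a map $f:P\to\mathbb R^d$ with $x\le y$ in $P$ if and only if $f(x)\le f(y)$ componentwise. Equivalently, it is the smallest $d$ such that $P$ is the intersection (as relations) of $d$ linear extensions. The weak order on a finite Coxeter group $W$ with its set of simple reflections is the partial order $u\le w$ if and only if $\ell(w)=\ell(u)+\ell(u^{-1}w)$, where $\ell$ is the length function. Equivalently (up to isomorphism), it is the poset of regions of the Coxeter arrangement of $W$ (the set of all reflecting hyperplanes): fix a region $B$, for each region $R$ let $S(R)$ be the set of hyperplanes separating $R$ from $B$, and set $R_1\le R_2$ if and only if $S(R_1)\subseteq S(R_2)$. The types $A_n,B_n,D_n,E_6,E_7,E_8,F_4,H_3,H_4,I_2(m)$ are the standard names of the irreducible finite Coxeter groups, the subscript being the rank (so $A_n$ is the symmetric group on $n+1$ letters, $B_n$ the group of signed permutations of $n$ letters, and $I_2(m)$ the dihedral group of order $2m$). The type $G_2$ is $I_2(6)$. 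*)

(* Defs.v *)
From HB Require Import structures.
From mathcomp Require Import all_boot all_order all_algebra all_fingroup.
From mathcomp Require Import boolp reals.

Set Implicit Arguments.
Unset Strict Implicit.
Unset Printing Implicit Defensive.

Import Order.TTheory GRing.Theory Num.Theory.

Section OrderDimension.
Variables (R : realType) (disp : Order.disp_t) (P : finPOrderType disp).

Definition embeds_in_dim (d : nat) : Prop :=
  exists f : P -> 'rV[R]_d,
    forall x y : P, (x <= y)%O <-> forall i, (f x 0 i <= f y 0 i)%R.

Lemma embeds_in_card : embeds_in_dim #|P|.
Proof.
exists (fun x => \row_i (enum_val i <= x)%O%:R)%R => x y; split=> [le_xy i|le_xy].
  rewrite !mxE ler_nat; case: (boolP (enum_val i <= x)%O) => // le_ix.
  by rewrite (le_trans le_ix le_xy).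
have := le_xy (enum_rank x); rewrite !mxE enum_rankK lexx ler_nat.
by case: (x <= y)%O.
Qed.

Lemma ex_embeds_in_dim : exists d, `[< embeds_in_dim d >].
Proof. by exists #|P|; apply/asboolP/embeds_in_card. Qed.

Definition order_dim : nat := ex_minn ex_embeds_in_dim.

End OrderDimension.

Arguments order_dim R {disp} P.

(* A finite group presented by generators s_i and relations
   (s_i s_j)^{M i j} = 1; [cox_lift] is the existence half of the universal
   property of the presentation, its uniqueness half being [cox_gen]. *)
Record coxeterSystem (n : nat) (M : 'M[nat]_n) := CoxeterSystem {
  cox_group :> finGroupType;
  simple : 'I_n -> cox_group;
  cox_rel : forall i j, ((simple i * simple j) ^+ M i j = 1)%g;
  cox_gen : <<[set simple i | i : 'I_n]>>%g = [set: cox_group];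
  cox_lift : forall (H : groupType) (t : 'I_n -> H),
    (forall i j, ((t i * t j) ^+ M i j = 1)%g) ->
    exists phi : {multiplicative cox_group -> H},
      forall i, phi (simple i) = t i
}.

Section Length.
Local Open Scope group_scope.
Variables (n : nat) (M : 'M[nat]_n) (W : coxeterSystem M).
Implicit Types u v w : W.

Definition is_product_of (w : W) (k : nat) : bool :=
  [exists t : k.-tuple 'I_n, w == \prod_(i <- t) simple W i].

Lemma ex_is_product_of w : exists k, is_product_of w k.
Proof.
have: w \in <<[set simple W i | i : 'I_n]>> by rewrite cox_gen inE.
case/gen_prodgP=> k [c cS ->].
have {}cS i : exists j, simple W j == c i.
  by have /imsetP[j _ ->] := cS i; exists j.
exists k; apply/existsP; exists [tuple xchoose (cS i) | i < k].
apply/eqP; rewrite big_tuple; apply: eq_bigr => i _.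
by rewrite tnth_mktuple (eqP (xchooseP (cS i))).
Qed.

Definition cox_length w : nat := ex_minn (ex_is_product_of w).

Lemma cox_lengthP w :
  exists2 s : seq 'I_n, size s = cox_length w & w = \prod_(i <- s) simple W i.
Proof.
rewrite /cox_length; case: ex_minnP => k /existsP[t /eqP ->] _.
by exists t; rewrite ?size_tuple.
Qed.

Lemma cox_length_min (s : seq 'I_n) :
  (cox_length (\prod_(i <- s) simple W i) <= size s)%N.
Proof.
rewrite /cox_length; case: ex_minnP => k _; apply.
by apply/existsP; exists (in_tuple s).
Qed.

Lemma cox_length1 : cox_length 1 = 0%N.
Proof. by have := cox_length_min [::]; rewrite big_nil leqn0 => /eqP. Qed.

Lemma cox_length_eq0 w : cox_length w = 0%N -> w = 1.
Proof. by case: (cox_lengthP w) => -[_ -> _|i s <-]; rewrite ?big_nil. Qed.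

Lemma cox_lengthM u v : (cox_length (u * v) <= cox_length u + cox_length v)%N.
Proof.
have [s <- u_s] := cox_lengthP u; have [t <- v_t] := cox_lengthP v.
by rewrite u_s v_t -big_cat -size_cat cox_length_min.
Qed.

Definition weak_le u w : bool :=
  cox_length w == (cox_length u + cox_length (u^-1 * w))%N.

Lemma weak_le_refl : reflexive weak_le.
Proof. by move=> w; rewrite /weak_le mulVg cox_length1 addn0. Qed.

Lemma weak_le_anti : antisymmetric weak_le.
Proof.
move=> u w /andP[/eqP le_uw /eqP le_wu].
have /cox_length_eq0 uw1: cox_length (u^-1 * w) = 0%N.
  apply/eqP; rewrite -leqn0 -(leq_add2l (cox_length u)) addn0 -le_uw.
  by rewrite le_wu leq_addr.
by rewrite -(mulKVg u w) uw1 mulg1.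
Qed.

Lemma weak_le_trans : transitive weak_le.
Proof.
move=> v u w /eqP le_uv /eqP le_vw; rewrite /weak_le eqn_leq.
rewrite -{1}(mulKVg u w) cox_lengthM /= le_vw le_uv -addnA leq_add2l.
by rewrite -[X in u^-1 * X](mulKVg v) mulgA cox_lengthM.
Qed.

End Length.

Definition weak_order (n : nat) (M : 'M[nat]_n) (W : coxeterSystem M) : Type := W.

Fact weak_display : Order.disp_t. Proof. exact: Order.Disp tt tt. Qed.

Section WeakOrder.
Variables (n : nat) (M : 'M[nat]_n) (W : coxeterSystem M).

HB.instance Definition _ := Finite.on (weak_order W).
HB.instance Definition _ := Order.Le_isPOrder.Build weak_display (weak_order W)
  (@weak_le_refl n M W) (@weak_le_anti n M W) (@weak_le_trans n M W).

End WeakOrder.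

(* The nodes of a Coxeter diagram are 0, ..., n - 1, and ((i, j), m) is an edge
   between i and j labelled m; m = 3 for the edges that are usually drawn
   without a label. *)
Definition diagram := seq (nat * nat * nat).

Definition edge_label (E : diagram) (i j : nat) : nat :=
  head 2 [seq e.2 | e <- E & (e.1 == (i, j)) || (e.1 == (j, i))].

Definition coxeter_matrix (n : nat) (E : diagram) : 'M[nat]_n :=
  \matrix_(i, j) if i == j then 1 else edge_label E i j.

Definition path_diagram (k : nat) : diagram :=
  [seq (i, i.+1, 3) | i <- iota 0 k.-1].

Definition type_A n := coxeter_matrix n (path_diagram n).

Definition type_B n :=
  coxeter_matrix n (rcons (path_diagram n.-1) (n - 2, n - 1, 4)).

Definition type_D n :=
  coxeter_matrix n (rcons (path_diagram n.-1) (n - 3, n - 1, 3)).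

Definition type_E n :=
  coxeter_matrix n (rcons (path_diagram n.-1) (2, n - 1, 3)).

Definition type_F4 := coxeter_matrix 4 [:: (0, 1, 3); (1, 2, 4); (2, 3, 3)].

Definition type_H n := coxeter_matrix n ((0, 1, 5) :: behead (path_diagram n)).

Definition type_I2 m := coxeter_matrix 2 [:: (0, 1, m)].

(* Main.v *)
Require Import Defs.
From HB Require Import structures.
From mathcomp Require Import all_boot all_order all_algebra all_fingroup.
From mathcomp Require Import boolp reals trigo.
From mathcomp Require Import zify ring lra.

(** Positions in the weak order are read off from root systems.  Let a Coxeter
    group W act linearly on a real vector space with a finite list of positive
    roots, and let N(w) be the set of positive roots b such that w^-1 b is
    negative.  Then the length of w is the cardinal of N(w), and u <= w in the
    weak order if and only if N(u) is contained in N(w) ([weak_leE]).  The action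
    comes from the presentation ([cox_action]), and the statement on lengths from
    the fact that w a_i is positive when s_i does not shorten w on the right
    ([height_act_simple]).

    Lower bounds ([rank_le_order_dim]).  If w0 inverts all simple roots, then
    s_j w0 inverts all of them but the j-th one, so that s_i <= s_j w0 exactly
    when i <> j.  The simple reflections and the elements s_j w0 thus form a
    standard example, whose order dimension is the rank.

    Upper bounds ([order_dim_le_chains]).  Call a sequence of positive roots a
    chain when each entry b is a nonnegative combination p c + q d of any
    earlier entry c and of some positive root d <> b.  If the positive roots
    are the union of k chains, then the order dimension is at most k: the j-th
    coordinate of x is the trace of N(x) on the j-th chain, read as a word of
    zeros and ones and compared lexicographically.  Indeed, if x is not below
    y, replace x by an element below it that is minimal with this property.
    Then N(x) is N(z) plus one root b, for some z <= y, and b is not in N(y).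
    Take c before b in the chain of b, with b = p c + q d.  If c is in N(y) but
    not in N(x), then d is in N(x), because the complement of N(x) is closed
    under nonnegative combinations; as d <> b, this gives d in N(z), hence in
    N(y); as N(y) is closed as well, b is in N(y), a contradiction.  So b is
    the first place where x and y differ, and the coordinate of x is larger.

    It remains to exhibit, for each type, a root system with few chains.  In
    types A, B and D the roots are e_a - e_b, e_a and e_a + e_b, and the a-th
    chain is e_a - e_(a+1), e_a - e_(a+2), ..., then e_a (in type B), then
    e_(a-1) + e_a, ..., e_0 + e_a (in types B and D).  In type I2(m) the roots
    have angles 0, t, ..., (m-1)t with t = pi/m; the last one is a chain, and
    so are the others.  For the exceptional types, the positive roots are
    listed in their basis of simple roots, already sorted into 9, 11, 19, 5, 3
    and 6 chains, and the axioms of a root system and the chain conditions are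
    finite computations ([table_bounds]).  In types H3 and H4 the coefficients
    lie in Z[phi], with phi the golden ratio. *)

Set Implicit Arguments.
Unset Strict Implicit.
Unset Printing Implicit Defensive.

Import Order.TTheory GRing.Theory Num.Theory.

Local Open Scope ring_scope.

(** * Linear automorphisms and the action of a Coxeter group *)

(** The inverse is part of the data, so that the group operations are defined
    without a choice; being determined by the map, it does not affect equality. *)
Record linAut (R : pzRingType) (V : lmodType R) := LinAut {
  aut_fun :> V -> V;
  aut_inv : V -> V;
  autK : cancel aut_fun aut_inv;
  autVK : cancel aut_inv aut_fun;
  aut_linear : linear aut_fun
}.

Section LinAutGroup.
Variables (R : pzRingType) (V : lmodType R).
Implicit Types f g : linAut V.

Lemma linAut_ext f g : f =1 g -> f = g.
Proof.
case: f g => [f f' fK f'K fL] [g g' gK g'K gL] /= efg.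
have {}efg : f = g by apply: funext.
have ef'g' : f' = g'.
  by apply: funext => x; rewrite -{1}[x]g'K -efg fK.
by subst; congr LinAut; apply: Prop_irrelevance.
Qed.

HB.instance Definition _ := gen_eqMixin (linAut V).
HB.instance Definition _ := gen_choiceMixin (linAut V).

Lemma aut_inv_linear f : linear (aut_inv f).
Proof. by move=> a x y; apply: (can_inj (autK f)); rewrite aut_linear !autVK. Qed.

Fact linAut_one_linear : linear (@id V). Proof. by []. Qed.

Definition linAut_one : linAut V :=
  LinAut (fun=> erefl) (fun=> erefl) linAut_one_linear.

Definition linAut_inv f : linAut V :=
  LinAut (autVK f) (autK f) (@aut_inv_linear f).

Fact linAut_mul_linear f g : linear (f \o g).
Proof. by move=> a x y; rewrite /= !aut_linear. Qed.

Definition linAut_mul f g : linAut V :=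
  LinAut (can_comp (autK f) (autK g)) (can_comp (autVK g) (autVK f))
         (@linAut_mul_linear f g).

Fact linAut_mulA : associative linAut_mul.
Proof. by move=> f g h; apply: linAut_ext. Qed.
Fact linAut_mul1g : left_id linAut_one linAut_mul.
Proof. by move=> f; apply: linAut_ext. Qed.
Fact linAut_mulg1 : right_id linAut_one linAut_mul.
Proof. by move=> f; apply: linAut_ext. Qed.
Fact linAut_mulVg : left_inverse linAut_one linAut_inv linAut_mul.
Proof. by move=> f; apply: linAut_ext => x; exact: autK. Qed.
Fact linAut_mulgV : right_inverse linAut_one linAut_inv linAut_mul.
Proof. by move=> f; apply: linAut_ext => x; exact: autVK. Qed.

HB.instance Definition _ := isGroup.Build (linAut V) linAut_mulA linAut_mul1g
  linAut_mulg1 linAut_mulVg linAut_mulgV.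

End LinAutGroup.

(** This is the universal property of the presentation, applied to the group of
    linear automorphisms; the relations with i = j make each r i an involution. *)
Lemma cox_action (n : nat) (M : 'M[nat]_n) (W : coxeterSystem M)
    (R : pzRingType) (V : lmodType R) (r : 'I_n -> V -> V) :
    (forall i, linear (r i)) -> (forall i, M i i = 1%N) ->
    (forall i j v, iter (M i j) (r i \o r j) v = v) ->
  exists act : W -> V -> V,
    [/\ forall w, linear (act w), forall v, act 1%g v = v,
        forall u w v, act (u * w)%g v = act u (act w v)
      & forall i v, act (simple W i) v = r i v].
Proof.
move=> rL Mii rel.
have rK i : involutive (r i) by move=> v; have := rel i i v; rewrite Mii.
pose t i := LinAut (rK i) (rK i) (rL i).
have [|phi phit] := @cox_lift n M W (linAut V) t.
  move=> i j; apply: linAut_ext => v; rewrite -[RHS](rel i j v).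
  elim: (M i j) v => [//|m IHm] v.
  by rewrite expgSr iterSr -IHm.
have phi1 : phi 1%g = 1%g.
  by apply: (mulgI (phi 1%g)); rewrite -gmulfM !mulg1.
exists (fun w => aut_fun (phi w)); split=> [w|v|u w v|i v].
- exact: aut_linear.
- by rewrite phi1.
- by rewrite gmulfM.
- by rewrite phit.
Qed.

(** * Root systems *)

(** Grows on the left and always ends with j: when letters i and j are split off
    on the right of an element as long as possible, such a word comes off. *)
Fixpoint alt_word (n : nat) (i j : 'I_n) (k : nat) : seq 'I_n :=
  if k is k'.+1 then (if odd k' then i else j) :: alt_word i j k' else [::].

Lemma alt_wordS n (i j : 'I_n) k : alt_word j i k.+1 = rcons (alt_word i j k) i.
Proof.
elim: k => [//|k IHk]; rewrite [LHS]/= -/(alt_word j i k.+1) IHk /=.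
by case: (odd k).
Qed.

Lemma size_alt_word n (i j : 'I_n) k : size (alt_word i j k) = k.
Proof. by elim: k => //= k ->. Qed.

(** Positivity is measured by a linear form [height].  The field [alt_word_pos]
    ties the labels M i j to the geometry: it says that an alternating word shorter
    than M i j keeps a_i in the cone of a_i and a_j, so that M i j is the true order
    of s_i s_j and not a proper multiple of it. *)
Record root_system (R : realType) (n : nat) (M : 'M[nat]_n) (V : lmodType R) :=
  RootSystem {
  refl : 'I_n -> V -> V;
  simple_root : 'I_n -> V;
  height : V -> R;
  pos_roots : seq V;
  refl_linear : forall i, linear (refl i);
  height_linear : scalar height;
  label_diag : forall i, M i i = 1%N;
  label_gt1 : forall i j, i != j -> (1 < M i j)%N;
  refl_rel : forall i j v, iter (M i j) (refl i \o refl j) v = v;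
  refl_simple : forall i, refl i (simple_root i) = - simple_root i;
  simple_pos : forall i, simple_root i \in pos_roots;
  height_pos : forall b, b \in pos_roots -> 0 < height b;
  refl_pos : forall i b, b \in pos_roots -> b != simple_root i ->
    refl i b \in pos_roots;
  alt_word_pos : forall i j k, i != j -> (k < M i j)%N ->
    exists p q : R, [/\ 0 <= p, 0 <= q &
      foldr refl (simple_root i) (alt_word i j k) =
        p *: simple_root i + q *: simple_root j]
}.

Section Inversions.
Variables (R : realType) (n : nat) (M : 'M[nat]_n) (V : lmodType R).
Variables (S : root_system M V) (W : coxeterSystem M).
Variable act : W -> V -> V.
Hypothesis act_linear : forall w, linear (act w).
Hypothesis act1 : forall v, act 1%g v = v.
Hypothesis actM : forall u w v, act (u * w)%g v = act u (act w v).
Hypothesis act_simple : forall i v, act (simple W i) v = refl S i v.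

Local Notation h := (height S).
Local Notation s := (simple W).
Local Notation a := (simple_root S).
Local Notation Phi := (pos_roots S).
Local Notation "'l' w" := (cox_length w) (at level 10).

Lemma act_comb w p q (x y : V) : act w (p *: x + q *: y) = p *: act w x + q *: act w y.
Proof.
have act0 : act w 0 = 0.
  have := act_linear w 1 0 0; rewrite !scale1r addr0.
  by move/eqP; rewrite -subr_eq0 opprD addrA subrr sub0r oppr_eq0 => /eqP.
by rewrite act_linear -[q *: y]addr0 act_linear act0 addr0.
Qed.

Lemma actN w x : act w (- x) = - act w x.
Proof. by have := act_comb w (-1) 0 x 0; rewrite !scale0r !addr0 !scaleN1r. Qed.

Lemma h_comb p q (x y : V) : h (p *: x + q *: y) = p * h x + q * h y.
Proof.
have h0 : h 0 = 0.
  have := height_linear S 1 0 0; rewrite scale1r mul1r addr0.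
  by move/eqP; rewrite -subr_eq0 opprD addrA subrr sub0r oppr_eq0 => /eqP.
by rewrite (height_linear S) -[q *: y]addr0 (height_linear S) h0 addr0.
Qed.

Lemma hN x : h (- x) = - h x.
Proof.
by have := h_comb (-1) 0 x 0; rewrite !scale0r !mul0r !addr0 scaleN1r mulN1r.
Qed.

Lemma actK w v : act w^-1%g (act w v) = v.
Proof. by rewrite -actM mulVg. Qed.

Lemma actVK w v : act w (act w^-1%g v) = v.
Proof. by rewrite -actM mulgV. Qed.

Lemma mulss i : (s i * s i)%g = 1%g.
Proof. by have := cox_rel W i i; rewrite (label_diag S) expg1. Qed.

Lemma mulsK i w : (w * s i * s i)%g = w.
Proof. by rewrite -mulgA mulss mulg1. Qed.

Lemma cox_ind (P : W -> Prop) :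
  P 1%g -> (forall i w, P w -> P (s i * w)%g) -> forall w, P w.
Proof.
move=> P1 PM w; have [t _ ->] := cox_lengthP w.
by elim: t => [|i t IHt]; rewrite ?big_nil // big_cons; apply: PM.
Qed.

Definition is_root v := (v \in Phi) || (- v \in Phi).

Lemma act_root w v : is_root v -> is_root (act w v).
Proof.
elim/cox_ind: w v => [|i w IHw] v rv; first by rewrite act1.
rewrite actM act_simple; have {IHw rv} := IHw v rv.
move: (act w v) => {w}v.
have reflN x : refl S i (- x) = - refl S i x by rewrite -!act_simple actN.
case/orP => vP;
  [case: (eqVneq v (a i)) => [->|ne] | case: (eqVneq (- v) (a i)) => [ev|ne]].
- by rewrite refl_simple /is_root opprK simple_pos orbT.
- by rewrite /is_root refl_pos.
- by rewrite -[v]opprK ev reflN refl_simple opprK /is_root simple_pos.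
- by rewrite /is_root -reflN (refl_pos vP ne) orbT.
Qed.

Lemma root_pos v : is_root v -> 0 < h v -> v \in Phi.
Proof.
by case/orP => // /height_pos; rewrite hN; lra.
Qed.

Lemma root_neg v : is_root v -> h v < 0 -> - v \in Phi.
Proof. by case/orP => // /height_pos; lra. Qed.

Lemma root_h_neq0 v : is_root v -> h v != 0.
Proof. by case/orP => /height_pos; rewrite ?hN; lra. Qed.

Lemma act_h_neq0 w b : b \in Phi -> h (act w b) != 0.
Proof. by move=> bP; apply/root_h_neq0/act_root; rewrite /is_root bP. Qed.

Definition inverted (w : W) (b : V) : bool := h (act w^-1%g b) < 0.

Lemma invertedF w b : b \in Phi -> ~~ inverted w b = (0 < h (act w^-1%g b)).
Proof. by move=> /(act_h_neq0 w^-1%g); rewrite /inverted; case: ltgtP. Qed.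

(** With [not_inverted_comb], this says that inversion sets are biclosed.  The
    heights of the images of c and d combine to that of the image of b, which
    cannot vanish because the image of b is a root. *)
Lemma inverted_comb w b c d p q : b \in Phi -> 0 <= p -> 0 <= q ->
  b = p *: c + q *: d -> inverted w c -> inverted w d -> inverted w b.
Proof.
move=> bP p0 q0 eb; rewrite /inverted => wc wd; have := act_h_neq0 w^-1%g bP.
rewrite eb act_comb h_comb => ne0; rewrite lt_neqAle ne0 /=.
by rewrite -oppr_ge0 opprD -!mulrN addr_ge0 ?mulr_ge0 // oppr_ge0 ltW.
Qed.

Lemma not_inverted_comb w b c d p q : c \in Phi -> d \in Phi -> b \in Phi ->
  0 <= p -> 0 <= q -> b = p *: c + q *: d ->
  ~~ inverted w c -> ~~ inverted w d -> ~~ inverted w b.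
Proof.
move=> cP dP bP p0 q0 eb; rewrite !invertedF // => wc wd.
have := act_h_neq0 w^-1%g bP; rewrite eb act_comb h_comb => ne0.
by rewrite lt_def ne0 /= addr_ge0 ?mulr_ge0 // ltW.
Qed.

(** The reflection s_j maps a_i into the cone of a_i and a_j, both inverted by w. *)
Lemma inverted_simpleM i w j : i != j ->
  inverted w (a i) -> inverted w (a j) -> inverted (s j * w) (a i).
Proof.
move=> nij wi wj; rewrite /inverted invMg actM.
have -> : ((s j)^-1 = s j)%g by apply/eqP; rewrite eq_invg_mul mulss.
rewrite act_simple.
have [p [q [p0 q0 e]]] := alt_word_pos S nij (label_gt1 S nij).
rewrite /= in e; rewrite e.
have rP : is_root (refl S j (a i)).
  by rewrite -act_simple; apply: act_root; rewrite /is_root simple_pos.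
have := root_h_neq0 (act_root w^-1%g rP).
rewrite e act_comb h_comb => ne0; rewrite lt_neqAle ne0 /=.
by rewrite -oppr_ge0 opprD -!mulrN addr_ge0 ?mulr_ge0 // oppr_ge0 ltW.
Qed.

(** * Inversions are counted by the length *)

Definition inv_set w : {set seq_sub Phi} := [set x | inverted w (val x)].

Lemma abs_act_proof w (x : seq_sub Phi) :
  (if 0 < h (act w (val x)) then act w (val x) else - act w (val x)) \in Phi.
Proof.
have rx : is_root (act w (val x)) by apply: act_root; rewrite /is_root (ssvalP x).
case: ltrP => hx; first exact: root_pos.
by apply: root_neg => //; rewrite lt_neqAle hx root_h_neq0.
Qed.

Definition abs_act w x : seq_sub Phi := SeqSub (abs_act_proof w x).

Lemma abs_act_inj w : injective (abs_act w).
Proof.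
move=> x y /(congr1 val) /= e; apply: val_inj => /=.
have: act w (val x) = act w (val y) \/ act w (val x) = - act w (val y).
  case: ifP e => _; case: ifP => _ e; [by left | by right | right | left].
    by rewrite -[LHS]opprK e.
  exact: oppr_inj.
case=> /(congr1 (act w^-1%g)); rewrite ?actN !actK //= => e'.
have /height_pos := ssvalP x; have /height_pos := ssvalP y.
by rewrite /= e' hN oppr_gt0 => hy; rewrite ltNge ltW.
Qed.

(** N(v) is reindexed along b |-> |u^-1 b|, which permutes the positive roots.
    The two sides then agree for each root b separately, whatever the signs of
    u^-1 b and of v^-1 u^-1 b. *)
Lemma card_inv_setM u v :
  (#|inv_set (u * v)| + 2 * #|inv_set u :\: inv_set (u * v)|
   = #|inv_set u| + #|inv_set v|)%N.
Proof.
have cardE (A : {set seq_sub Phi}) : #|A| = (\sum_x (x \in A))%N.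
  by rewrite -sum1_card big_mkcond.
rewrite !cardE [X in (_ = _ + X)%N](reindex_inj (@abs_act_inj u^-1%g)).
rewrite big_distrr -!big_split /=; apply: eq_bigr => x _.
rewrite !inE /= /inverted invMg actM.
have ne0 := act_h_neq0 u^-1%g (ssvalP x).
have: h (act v^-1%g (act u^-1%g (ssval x))) != 0.
  by rewrite -actM act_h_neq0 // ssvalP.
case: (ltgtP (h (act u^-1%g (ssval x))) 0) ne0 => //= hx _;
  rewrite ?actN ?hN ?oppr_lt0;
  by case: (ltgtP (h (act v^-1%g (act u^-1%g (ssval x)))) 0).
Qed.

(** Cardinals of inversion sets add up exactly when no inversion is cancelled. *)
Lemma sub_inv_setE u v :
  (inv_set u \subset inv_set (u * v)) =
    (#|inv_set (u * v)| == #|inv_set u| + #|inv_set v|)%N.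
Proof.
rewrite -card_inv_setM -setD_eq0 -cards_eq0.
by rewrite -{1}[#|inv_set (u * v)|]addn0 eqn_add2l [in RHS]eq_sym muln_eq0.
Qed.

Lemma inverted_simple i b : b \in Phi -> inverted (s i) b = (b == a i).
Proof.
move=> bP; rewrite /inverted.
have -> : ((s i)^-1 = s i)%g by apply/eqP; rewrite eq_invg_mul mulss.
rewrite act_simple; case: eqVneq => [->|ne].
  by rewrite refl_simple hN oppr_lt0 height_pos // simple_pos.
by have := height_pos (refl_pos bP ne); case: ltgtP.
Qed.

Lemma card_inv_set1 : #|inv_set 1| = 0%N.
Proof.
apply/eqP; rewrite cards_eq0; apply/eqP/setP=> x; rewrite !inE /inverted.
by rewrite invg1 act1; apply/negbTE; rewrite -leNgt ltW // height_pos // ssvalP.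
Qed.

Lemma card_inv_set_simple i : #|inv_set (s i)| = 1%N.
Proof.
rewrite (_ : inv_set _ = [set SeqSub (simple_pos S i)]) ?cards1 //.
by apply/setP=> x; rewrite !inE inverted_simple ?(ssvalP x) // -val_eqE.
Qed.

(** The reflection s_i reverses the sign of +-a_i only, so passing from w to w s_i
    affects the root w a_i only. *)
Lemma inv_set_simple w i : 0 < h (act w (a i)) ->
  #|inv_set (w * s i)| = #|inv_set w|.+1.
Proof.
move=> wi; apply/eqP; rewrite -addn1 -(card_inv_set_simple i) -sub_inv_setE.
apply/subsetP=> x; rewrite !inE => wx.
rewrite /inverted invMg actM; set b := act w^-1%g (val x).
have bP : - b \in Phi.
  by apply: root_neg => //; apply: act_root; rewrite /is_root (ssvalP x).
rewrite -[b]opprK actN hN oppr_lt0; case: ltgtP (act_h_neq0 (s i)^-1%g bP) => //.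
rewrite -/(inverted (s i) (- b)) inverted_simple // => /eqP eb _.
by move: wi; rewrite -eb actN actVK hN oppr_gt0 ltNge ltW // height_pos // ssvalP.
Qed.

Local Notation wprod t := (\prod_(i <- t) s i)%g.

Lemma act_word t v : act (wprod t) v = foldr (refl S) v t.
Proof.
by elim: t => [|i t IHt]; rewrite ?big_nil // big_cons actM IHt act_simple.
Qed.

(** The quotient of the two words of length k is the k-th power of s_i s_j or of
    s_j s_i. *)
Lemma alt_word_braid i j : wprod (alt_word i j (M i j)) = wprod (alt_word j i (M i j)).
Proof.
have e k : wprod (alt_word i j k) =
    ((if odd k then s j * s i else s i * s j) ^+ k * wprod (alt_word j i k))%g.
  elim: k => [|k IHk]; first by rewrite expg0 mul1g.
  rewrite /= !big_cons IHk; set P := wprod (alt_word j i k).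
  have shift x y : (x * (y * x) ^+ k * y = (x * y) ^+ k.+1 :> W)%g.
    elim: (k) => [|k' IH']; first by rewrite expg0 mulg1 expg1.
    by rewrite expgS [RHS]expgS -IH' !mulgA.
  by case: (odd k) => /=; rewrite -shift !mulgA mulsK.
rewrite {1}e; suff -> : ((if odd (M i j) then s j * s i else s i * s j) ^+ M i j = 1)%g.
  by rewrite mul1g.
case: ifP => _; last exact: cox_rel.
have -> : (s j * s i = (s i * s j)^-1)%g.
  apply/eqP; rewrite eq_sym eq_invg_mul.
  by rewrite mulgA mulsK mulss.
by rewrite expVgn cox_rel invg1.
Qed.

Lemma cox_length_simple w i : (l (w * s i)%g <= (l w).+1)%N.
Proof.
have [t <- ->] := cox_lengthP w.
by have := cox_length_min W (rcons t i); rewrite -cats1 big_cat big_seq1 size_cat addn1.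
Qed.

(** From length M i j on, the braid relation turns the end of the word into i,
    which cancels against the additional s_i. *)
Lemma cox_length_alt_simple i j k : i != j -> (M i j <= k)%N ->
  (l (wprod (alt_word i j k) * s i)%g < k)%N.
Proof.
move=> nij; have m_gt1 := label_gt1 S nij.
elim: k => [|k IHk]; first by move=> /(leq_trans m_gt1).
rewrite leq_eqVlt => /orP[/eqP ek|/IHk {}IHk]; last first.
  rewrite /= big_cons -mulgA ltnS (leq_trans (cox_lengthM _ _)) //.
  apply: leq_trans IHk; rewrite -add1n leq_add2r.
  by have := cox_length_min W [:: (if odd k then i else j)]; rewrite big_seq1.
rewrite -ek alt_word_braid ek alt_wordS -cats1 big_cat big_seq1 mulsK.
by rewrite ltnS -[X in (_ <= X)%N](size_alt_word i j k) cox_length_min.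
Qed.

(** The length function sees the sign of roots.  By induction on the length of w:
    let j be the last letter of a reduced word of w, and write w = v x with
    lengths adding up, where x is an alternating word in s_i and s_j ending with
    s_j, as long as possible.  Then neither s_i nor s_j shortens v, so by
    induction v maps a_i and a_j to positive roots.  Moreover x is shorter than
    M i j, since otherwise s_i would shorten w; hence x a_i lies in the cone of
    a_i and a_j, and w a_i = v (x a_i) is positive. *)
Lemma height_act_simple w i : (l w <= l (w * s i)%g)%N -> 0 < h (act w (a i)).
Proof.
have [N] := ubnP (l w); elim: N w i => // N IHN w i /ltnSE lw_le wi.
have [t tw ew] := cox_lengthP w.
case/lastP: t => [|t j] in tw ew.
  by rewrite ew big_nil act1 height_pos // simple_pos.
have nij : i != j.
  apply: contraTneq wi => ->; rewrite -ltnNge -tw ew -cats1 big_cat big_seq1 mulsK.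
  by rewrite size_cat addn1 ltnS cox_length_min.
have ew' : w = (wprod t * s j)%g by rewrite ew -cats1 big_cat big_seq1.
(* The alternating word takes over letters from v until neither reflection
   shortens v; the length of v bounds the number of rounds. *)
suff loop q v k : (l v < q)%N -> w = (v * wprod (alt_word i j k.+1))%g ->
    (l w = l v + k.+1)%N -> 0 < h (act w (a i)).
  apply: (loop _ (wprod t) 0 (ltnSn _)); first by rewrite big_seq1.
  apply/eqP; rewrite addn1 eqn_leq [in X in (X <= _)%N]ew' cox_length_simple.
  by rewrite -tw size_rcons ltnS cox_length_min.
elim: q v k => // q IHq v k /ltnSE lv_le ewv lwv.
set x := if odd k then i else j; set y := if odd k then j else i.
have ewx : w = (v * s x * wprod (alt_word i j k))%g.
  by rewrite ewv /= big_cons mulgA.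
have lvx : (l v <= l (v * s x))%N.
  rewrite leqNgt; apply/negP=> lt.
  have := cox_lengthM (v * s x) (wprod (alt_word i j k)).
  have := cox_length_min W (alt_word i j k); rewrite -ewx size_alt_word lwv.
  by move: lt; lia.
have [lvy|lvy] := leqP (l v) (l (v * s y)); last first.
  have ewy : w = (v * s y * wprod (alt_word i j k.+2))%g.
    have -> : alt_word i j k.+2 = y :: alt_word i j k.+1.
      by rewrite /y /=; case: (odd k).
    by rewrite ewv [in RHS]big_cons mulgA mulsK.
  apply: (IHq _ _ _ ewy); first exact: leq_trans lvy lv_le.
  have := cox_lengthM (v * s y) (wprod (alt_word i j k.+2)).
  have := cox_length_min W (alt_word i j k.+2); rewrite -ewy size_alt_word lwv.
  by move: lvy; lia.
have lvN : (l v < N)%N by move: lw_le; rewrite lwv; lia.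
have k_lt : (k.+1 < M i j)%N.
  rewrite ltnNge; apply/negP=> /(cox_length_alt_simple nij) lt.
  have := cox_lengthM v (wprod (alt_word i j k.+1) * s i).
  rewrite mulgA -ewv => /(leq_trans wi); rewrite lwv leq_add2l.
  by rewrite leqNgt lt.
have hx := IHN _ _ lvN lvx; have hy := IHN _ _ lvN lvy.
have /andP[hi hj] : (0 < h (act v (a i))) && (0 < h (act v (a j))).
  by move: hx hy; rewrite /x /y; case: (odd k) => -> ->.
have [p [c [p0 c0 e]]] := alt_word_pos S nij k_lt.
have : h (act w (a i)) != 0 by rewrite act_h_neq0 // simple_pos.
rewrite ewv actM act_word e act_comb h_comb => ne0; rewrite lt_def ne0 /=.
by rewrite addr_ge0 ?mulr_ge0 // ltW.
Qed.

(** Along a reduced word, each letter adds one inversion. *)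
Lemma cox_length_inv w : l w = #|inv_set w|.
Proof.
have [N] := ubnP (l w); elim: N w => // N IHN w /ltnSE lw_le.
have [t tw ew] := cox_lengthP w.
case/lastP: t => [|t j] in tw ew.
  by rewrite ew big_nil card_inv_set1 cox_length1.
have ew' : w = (wprod t * s j)%g by rewrite ew -cats1 big_cat big_seq1.
have lt : (l (wprod t) < l w)%N by rewrite -tw size_rcons ltnS cox_length_min.
have le := cox_length_simple (wprod t) j; rewrite -ew' in le.
rewrite [in RHS]ew' inv_set_simple; last by apply: height_act_simple; rewrite -ew' ltnW.
by rewrite -IHN; [apply/eqP; rewrite eqn_leq le lt | apply: leq_trans lt lw_le].
Qed.

(** Since length counts inversions, l(w) = l(u) + l(u^-1 w) means that the
    inversions of u and those contributed by u^-1 w do not cancel. *)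
Lemma weak_leE u w :
  weak_le u w <-> {in Phi, forall b, inverted u b -> inverted w b}.
Proof.
have -> : weak_le u w = (inv_set u \subset inv_set w).
  by rewrite /weak_le !cox_length_inv -{3}(mulKVg u w) sub_inv_setE mulKVg.
split=> [/subsetP sub b bP ub|sub].
  by have := sub (SeqSub bP); rewrite !inE; apply.
by apply/subsetP=> x; rewrite !inE; apply/sub/ssvalP.
Qed.

(** The element z is obtained by deleting the last letter of a reduced word. *)
Lemma weak_le_pred w : w != 1%g -> exists z b, [/\ weak_le z w, z != w &
  {in Phi, forall c, inverted w c -> c = b \/ inverted z c}].
Proof.
move=> w1; have [t tw ew] := cox_lengthP w.
case/lastP: t => [|t j] in tw ew; first by rewrite ew big_nil eqxx in w1.
have {}ew : w = (wprod t * s j)%g by rewrite ew -cats1 big_cat big_seq1.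
have lt_w : (l (wprod t) < l w)%N by rewrite -tw size_rcons ltnS cox_length_min.
exists (wprod t), (act (wprod t) (a j)); split.
- rewrite /weak_le eqn_leq -{1}(mulKVg (wprod t) w) cox_lengthM /=.
  apply: leq_trans lt_w; rewrite -addn1 leq_add2l ew mulKg.
  by have := cox_length_min W [:: j]; rewrite big_seq1.
- by apply: contraTneq lt_w => ->; rewrite ltnn.
- move=> c cP; case: (boolP (inverted (wprod t) c)); first by right.
  rewrite invertedF // => tc wc; left.
  set d := act (wprod t)^-1%g c in tc.
  have dP : d \in Phi by apply: root_pos tc; apply: act_root; rewrite /is_root cP.
  move: wc; rewrite ew /inverted invMg actM -/d -/(inverted (s j) d).
  by rewrite inverted_simple // => /eqP <-; rewrite /d actVK.
Qed.

(** An element w0 with the largest number of inversions inverts all simple roots,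
    for otherwise s_k w0 would have one more inversion. *)
Lemma exists_coatoms : exists w0 : W, forall i j,
  inverted (s j * w0) (a i) = (i != j).
Proof.
have [w0 _ w0_max] : {w0 | true & forall w, (#|inv_set w| <= #|inv_set w0|)%N}.
  case: (@arg_maxnP W 1%g xpredT (fun w => #|inv_set w|)) => // w0 _ w0_max.
  by exists w0 => // w; apply: w0_max.
have flip k : inverted (s k * w0) (a k) = ~~ inverted w0 (a k).
  rewrite invertedF ?simple_pos // /inverted invMg actM.
  have -> : ((s k)^-1 = s k)%g by apply/eqP; rewrite eq_invg_mul mulss.
  by rewrite act_simple refl_simple actN hN oppr_lt0.
have w0i k : inverted w0 (a k).
  apply/negPn/negP; rewrite -flip => sw0.
  have := w0_max (s k * w0)%g.
  suff: inv_set (s k) \subset inv_set (s k * w0).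
    by rewrite sub_inv_setE card_inv_set_simple => /eqP ->; rewrite add1n ltnn.
  apply/subsetP=> x; rewrite !inE inverted_simple ?(ssvalP x) // => /eqP e.
  by rewrite /= e.
exists w0 => i j; case: (eqVneq i j) => [<-|nij]; last exact: inverted_simpleM.
by rewrite flip w0i.
Qed.

End Inversions.

(** * Bounds on the order dimension *)

(** The number with binary digits t, the first one being the most significant: on
    words of equal length, its order is the lexicographic order. *)
Fixpoint lex_code (t : seq bool) : nat :=
  if t is b :: t' then (b * 2 ^ size t' + lex_code t')%N else 0%N.

Lemma lex_code_lt t : (lex_code t < 2 ^ size t)%N.
Proof. by elim: t => //= b t IHt; rewrite expnS; case: b; lia. Qed.

Lemma lex_code_le T (c : seq T) (f g : T -> bool) :
  (forall x, f x -> g x) -> (lex_code (map f c) <= lex_code (map g c))%N.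
Proof.
move=> fg; elim: c => //= x c IHc; rewrite !size_map leq_add // leq_mul //.
by case: (f x) (fg x) => // ->.
Qed.

Lemma lex_code_first T (x0 : T) (c : seq T) (f g : T -> bool) k :
  (k < size c)%N -> (forall i, (i < k)%N -> f (nth x0 c i) = g (nth x0 c i)) ->
  ~~ f (nth x0 c k) -> g (nth x0 c k) ->
  (lex_code (map f c) < lex_code (map g c))%N.
Proof.
elim: c k => [//|x c IHc] [|k] /= lt_k fg; rewrite !size_map.
  move=> /negbTE -> ->; have := lex_code_lt (map f c); rewrite size_map; lia.
move=> fk gk; rewrite (fg 0%N isT) /= ltn_add2l; apply: (IHc k) => // i ltik.
exact: (fg i.+1).
Qed.

(** The condition d <> b excludes the void relation b = 0 c + 1 b.  For distinct
    c and b, the relation says that b is not one of the two extreme positive roots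
    of the rank two subsystem that contains them. *)
Definition precedes (R : realType) (n : nat) (M : 'M[nat]_n) (V : lmodType R)
    (S : root_system M V) (c b : V) : Prop :=
  exists d p q, [/\ d \in pos_roots S, d != b, 0 <= p, 0 <= q & b = p *: c + q *: d].

Definition is_chain (R : realType) (n : nat) (M : 'M[nat]_n) (V : lmodType R)
    (S : root_system M V) (c : seq V) : Prop :=
  forall k l, (k < l < size c)%N -> precedes S (nth 0 c k) (nth 0 c l).

Section Bounds.
Variables (R : realType) (n : nat) (M : 'M[nat]_n) (V : lmodType R).
Variables (S : root_system M V) (W : coxeterSystem M).

Local Notation Phi := (pos_roots S).
Local Notation a := (simple_root S).
Local Notation s := (simple W).

(** Biclosedness enters through the root d with b = p c + q d, where c is in N(y)
    but not in N(x): as the complement of N(x) is closed, d is in N(x), hence in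
    N(y) by minimality of x; as N(y) is closed, b would be in N(y). *)
Theorem order_dim_le_chains (chains : seq (seq V)) :
  Phi = flatten chains -> {in chains, forall c, is_chain S c} ->
  (order_dim R (weak_order W) <= size chains)%N.
Proof.
move=> ePhi chainP.
have [act [actL act1 actM actS]] :=
  cox_action W (refl_linear S) (label_diag S) (refl_rel S).
pose N := inverted S act.
have leE x y : (x <= y :> weak_order W)%O <-> {in Phi, forall b, N x b -> N y b}.
  exact: (weak_leE actL act1 actM actS).
rewrite /order_dim; case: ex_minnP => m _; apply; apply/asboolP.
(* Membership in Phi is tested because [leE] compares inversions among roots. *)
pose code (x : weak_order W) c := lex_code [seq (b \in Phi) && N x b | b <- c].
exists (fun x => \row_(k < size chains) (code x (nth [::] chains k))%:R) => x y.
split=> [/leE le_xy i|].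
  rewrite !mxE ler_nat; apply: lex_code_le => b /andP[bP /(le_xy b bP) ->].
  by rewrite bP.
move=> le_code; apply/negPn/negP => nle_xy.
have Px : [pred z : weak_order W | (z <= x)%O && ~~ (z <= y)%O] x by rewrite /= lexx.
case: (arg_minnP (fun z : weak_order W => cox_length (z : W)) Px) => w /andP[le_wx
  nle_wy] w_min.
have w1 : (w : W) != 1%g.
  by apply: contraNneq nle_wy => ->;
    rewrite /Order.le /= /weak_le cox_length1 invg1 mul1g.
have [z [b [le_zw nzw wE]]] := weak_le_pred actL act1 actM actS w1.
have le_zy : (z <= y :> weak_order W)%O.
  apply: contraNT nzw => nle_zy; have := w_min z.
  rewrite /= nle_zy andbT (le_trans (le_zw : (z <= w :> weak_order W)%O) le_wx) =>
    /(_ isT).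
  move: le_zw; rewrite /weak_le => /eqP ->;
    rewrite -{2}[cox_length z]addn0 leq_add2l leqn0.
  by move=> /eqP/cox_length_eq0/eqP; rewrite -eq_invg_mul invgK.
have /leE le_zy' := le_zy.
have [c cPhi] : exists2 c, c \in Phi & N w c && ~~ N y c.
  apply/hasP; apply: contraNT nle_wy => /hasPn no; apply/leE => c cP wc.
  by have := no c cP; rewrite wc negbK.
move=> /andP[wc nyc]; have ecb : c = b.
  by have [//|zc] := wE c cPhi wc; rewrite (le_zy' c cPhi zc) in nyc.
subst b; have only d : d \in Phi -> N w d -> d != c -> N y d.
  by move=> dP wd /eqP ndc; have [//|zd] := wE d dP wd; apply: le_zy'.
have := cPhi; rewrite {1}ePhi => /flattenP[C CP cC].
have [k] : exists k : 'I_(size chains), nth [::] chains k = C.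
  by have := CP; rewrite -index_mem => kP; exists (Ordinal kP); rewrite nth_index.
move=> ek; have := le_code k; rewrite !mxE ek ler_nat leqNgt => /negP; apply.
have code_wx : (code w C <= code x C)%N.
  apply: lex_code_le => d /andP[dP wd]; rewrite dP /=.
  by have /leE := le_wx; apply.
apply: leq_trans code_wx.
apply: (@lex_code_first _ 0 _ _ _ (index c C));
  rewrite ?index_mem ?nth_index ?cPhi ?negb_and //=.
move=> i lti; set g := nth 0 C i.
have gP : g \in Phi.
  by rewrite ePhi; apply/flattenP; exists C => //; apply/mem_nth/(ltn_trans lti);
    rewrite index_mem.
have : precedes S g c.
  by have := chainP C CP i (index c C); rewrite nth_index // lti index_mem cC; apply.
move=> [d [p [q [dP ndc p0 q0 ec]]]]; rewrite gP /=; apply/idP/idP => [yg|wg];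
  last first.
  by apply: only => //; have /= -> := before_find 0 lti.
apply/negPn/negP => nwg.
have wd : N w d.
  apply/negPn/negP => nwd.
  by have := not_inverted_comb actL act1 actM actS gP dP cPhi p0 q0 ec nwg nwd;
    rewrite -/N wc.
have := inverted_comb actL act1 actM actS cPhi p0 q0 ec yg (only d dP wd ndc).
by rewrite -/N (negbTE nyc).
Qed.

(** In an embedding, some coordinate puts s_i above s_i w0; a coordinate doing so
    for both i and j would be cyclically increasing on s_i, s_j w0, s_j, s_i w0. *)
Theorem rank_le_order_dim : (n <= order_dim R (weak_order W))%N.
Proof.
have [act [actL act1 actM actS]] :=
  cox_action W (refl_linear S) (label_diag S) (refl_rel S).
have leE (x y : weak_order W) : (x <= y)%O <-> _ := weak_leE actL act1 actM actS x y.
rewrite /order_dim; case: ex_minnP => m /asboolP[f fP] _.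
have [w0 w0P] := exists_coatoms actL act1 actM actS.
pose c j : weak_order W := (s j * w0)%g.
have le_sc i j : (s i <= c j :> weak_order W)%O = (i != j).
  apply/idP/idP => [/leE le_ij|nij].
    rewrite -(w0P i j); apply: le_ij; first exact: simple_pos.
    by rewrite (inverted_simple actS) ?simple_pos.
  apply/leE => b bP; rewrite (inverted_simple actS) // => /eqP ->.
  by rewrite w0P.
have ex i : exists k, f (c i) 0 k < f (s i) 0 k.
  apply/existsP; rewrite -[X in is_true X]negbK negb_exists; apply/negP => /forallP no.
  have : (s i <= c i :> weak_order W)%O by apply/fP => k; rewrite leNgt no.
  by rewrite le_sc eqxx.
have g_inj : injective (fun i => xchoose (ex i)).
  move=> i j /= e; apply/eqP; apply/negPn/negP => nij.
  have := xchooseP (ex i); rewrite e; have := xchooseP (ex j).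
  set k := xchoose (ex j) => hj hi.
  have h1 : f (s i) 0 k <= f (c j) 0 k by apply: (fP _ _).1; rewrite le_sc.
  have h2 : f (s j) 0 k <= f (c i) 0 k by apply: (fP _ _).1; rewrite le_sc eq_sym.
  by have := lt_trans (lt_le_trans hj h2) (lt_le_trans hi h1); rewrite ltxx.
by have := leq_card _ g_inj; rewrite !card_ord.
Qed.

End Bounds.

(** * Root systems from Cartan matrices *)

Definition reflection (R : pzRingType) (V : lmodType R) (c : V -> R) (a v : V) : V :=
  v - c v *: a.

Lemma linear_reflection (R : comPzRingType) (V : lmodType R) (c : V -> R) (a : V) :
  scalar c -> linear (reflection c a).
Proof.
move=> cL p x y; rewrite /reflection cL scalerBr scalerDl scalerA.
by rewrite opprD addrACA.
Qed.

(** The entries c_i(a_j) and c_j(a_i) of a Cartan matrix when s_i s_j has order 2,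
    3, 4 or 5: they vanish together, and their product is 4 cos^2 (pi / m). *)
Inductive dihedral_label (R : realType) : nat -> R -> R -> Prop :=
| Label2 : dihedral_label 2 0 0
| Label3 : dihedral_label 3 (-1) (-1)
| Label4l : dihedral_label 4 (-1) (-2)
| Label4r : dihedral_label 4 (-2) (-1)
| Label5 phi of 0 <= phi & phi * phi = phi + 1 : dihedral_label 5 (- phi) (- phi).

Section Cartan.
Variables (R : realType) (n : nat) (M : 'M[nat]_n) (V : lmodType R).
Variables (c : 'I_n -> V -> R) (a : 'I_n -> V).
Hypothesis c_linear : forall i, scalar (c i).
Hypothesis c_diag : forall i, c i (a i) = 2.
Hypothesis M_diag : forall i, M i i = 1%N.
Hypothesis M_label : forall i j, i != j ->
  dihedral_label (M i j) (c i (a j)) (c j (a i)).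

Local Notation rf i := (reflection (c i) (a i)).

Lemma coroot_comb i (v x y : V) p q :
  c i (v + p *: x + q *: y) = c i v + p * c i x + q * c i y.
Proof. by rewrite addrC (c_linear i) [v + _]addrC (c_linear i); ring. Qed.

Lemma reflection_linear i : linear (rf i).
Proof. exact: linear_reflection. Qed.

Lemma reflection_simple i : rf i (a i) = - a i.
Proof. by rewrite /reflection c_diag scaler_nat mulr2n opprD addrA subrr sub0r. Qed.

Lemma dihedral_step i j (v : V) p q p' q' :
  q' = - c j v - p * c j (a i) - q -> p' = - c i v - q' * c i (a j) - p ->
  rf i (rf j (v + p *: a i + q *: a j)) = v + p' *: a i + q' *: a j.
Proof.
move=> eq' ep'; have -> : rf j (v + p *: a i + q *: a j) = v + p *: a i + q' *: a j.
  rewrite /reflection coroot_comb c_diag -addrA -scalerBl; congr (_ + _ *: _).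
  by rewrite eq'; ring.
rewrite /reflection coroot_comb c_diag addrAC -[v + _ - _]addrA -scalerBl.
by congr (_ + _ *: _ + _); rewrite ep'; ring.
Qed.

(** On the affine plane v + <a_i, a_j>, with coordinates (p, q), the product s_i s_j
    acts by an affine map [step], and it suffices to iterate it from the origin. *)
Lemma reflection_rel i j v : iter (M i j) (rf i \o rf j) v = v.
Proof.
case: (eqVneq i j) => [<-|nij].
  rewrite M_diag /= {1}/reflection (_ : c i (rf i v) = - c i v).
    by rewrite scaleNr opprK /reflection subrK.
  have := coroot_comb i v (a i) (a i) (- c i v) 0.
  by rewrite scale0r addr0 scaleNr /reflection => ->; rewrite c_diag; ring.
pose step (t : R * R) : R * R :=
  let q' := - c j v - t.1 * c j (a i) - t.2 in (- c i v - q' * c i (a j) - t.1, q').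
have stepE k : iter k (rf i \o rf j) v =
    v + (iter k step (0, 0)).1 *: a i + (iter k step (0, 0)).2 *: a j.
  elim: k => [|k IHk]; first by rewrite /= !scale0r !addr0.
  by rewrite iterS IHk; apply: dihedral_step.
rewrite stepE (_ : iter _ _ _ = (0, 0)) ?scale0r ?addr0 //.
case: (M_label nij) @step {stepE} => [||||phi _ phi2] step;
  rewrite /step /=; move: (c i v) (c j v) => p q; try by congr pair; ring.
(* With these, the iterates of [step] are compared by linear arithmetic. *)
have hp : phi * phi * p = (phi + 1) * p by rewrite phi2.
have hq : phi * phi * q = (phi + 1) * q by rewrite phi2.
have hp3 : phi * phi * phi * p = (phi * phi + phi) * p.
  by rewrite -(mulrA phi) {1}phi2 mulrDr mulr1.
have hq3 : phi * phi * phi * q = (phi * phi + phi) * q.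
  by rewrite -(mulrA phi) {1}phi2 mulrDr mulr1.
pose f (t : R * R) : R * R :=
  let q' := - q - t.1 * - phi - t.2 in (- p - q' * - phi - t.1, q').
(* The successive iterates, reduced by phi ^ 2 = phi + 1. *)
have e1 : f (0, 0) = (- phi * q - p, - q) by congr pair; rewrite /=; ring.
have e2 : f (- phi * q - p, - q) = (- (phi + 1) * (p + q), - (phi + 1) * q - phi * p).
  by congr pair; rewrite /=; lra.
have e3 : f (- (phi + 1) * (p + q), - (phi + 1) * q - phi * p) =
    (- phi * q - (phi + 1) * p, - (phi + 1) * (p + q)).
  by congr pair; rewrite /=; lra.
have e4 : f (- phi * q - (phi + 1) * p, - (phi + 1) * (p + q)) = (- p, - q - phi * p).
  by congr pair; rewrite /=; lra.
rewrite -[LHS]/(f (f (f (f (f (0, 0)))))) e1 e2 e3 e4.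
by congr pair; rewrite /=; lra.
Qed.

(** The coefficients are those of the roots of the rank two system spanned by a_i
    and a_j, computed letter by letter from 1 a_i + 0 a_j. *)
Lemma alt_word_nonneg i j k : i != j -> (k < M i j)%N ->
  exists p q : R, [/\ 0 <= p, 0 <= q &
    foldr (fun i => rf i) (a i) (alt_word i j k) = p *: a i + q *: a j].
Proof.
move=> nij.
have comb i' p q : rf i' (p *: a i + q *: a j) =
    p *: a i + q *: a j - (p * c i' (a i) + q * c i' (a j)) *: a i'.
  rewrite /reflection; have := coroot_comb i' 0 (a i) (a j) p q.
  have c0 : c i' 0 = 0.
    by have := c_linear i' 1 0 0; rewrite scaler0 addr0 => e; lra.
  by rewrite add0r c0 add0r => ->.
have ri p q : rf i (p *: a i + q *: a j) = (- q * c i (a j) - p) *: a i + q *: a j.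
  by rewrite comb addrAC -scalerBl c_diag; congr (_ *: _ + _); ring.
have rj p q : rf j (p *: a i + q *: a j) = p *: a i + (- p * c j (a i) - q) *: a j.
  by rewrite comb -addrA -scalerBl c_diag; congr (_ + _ *: _); ring.
have st p q k' : foldr (fun i => rf i) (a i) (alt_word i j k') = p *: a i + q *: a j ->
    foldr (fun i => rf i) (a i) (alt_word i j k'.+1) =
    if odd k' then (- q * c i (a j) - p) *: a i + q *: a j
              else p *: a i + (- p * c j (a i) - q) *: a j.
  by move=> e; rewrite /= e; case: (odd k'); rewrite ?ri ?rj.
have e0 : foldr (fun i => rf i) (a i) (alt_word i j 0) = 1 *: a i + 0 *: a j.
  by rewrite scale1r scale0r addr0.
have e1 := st _ _ _ e0; have e2 := st _ _ _ e1; have e3 := st _ _ _ e2.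
have e4 := st _ _ _ e3.
have fin p q : 0 <= p -> 0 <= q ->
  foldr (fun i => rf i) (a i) (alt_word i j k) = p *: a i + q *: a j ->
  exists p q : R, [/\ 0 <= p, 0 <= q &
    foldr (fun i => rf i) (a i) (alt_word i j k) = p *: a i + q *: a j].
  by move=> p0 q0 e; exists p, q.
move: k fin => [|[|[|[|[|k]]]]] fin lt_k; [apply: fin e0|apply: fin e1|
  apply: fin e2|apply: fin e3|apply: fin e4|exfalso];
  clear -M_label nij lt_k;
  case: (M_label nij) lt_k => [||||phi phi0 phi2] lt_k //; try lra;
  have phi3 : phi * phi * phi = phi * phi + phi by rewrite {1}phi2 mulrDl mul1r.
all: have phi4 : phi * phi * phi * phi = phi * phi * phi + phi * phi
  by rewrite {1}phi3 mulrDl.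
all: lra.
Qed.

Variables (h : V -> R) (Phi : seq V).
Hypothesis h_linear : scalar h.
Hypothesis a_pos : forall i, a i \in Phi.
Hypothesis h_pos : forall b, b \in Phi -> 0 < h b.
Hypothesis reflection_pos : forall i b, b \in Phi -> b != a i -> rf i b \in Phi.

Lemma cartan_label_gt1 i j : i != j -> (1 < M i j)%N.
Proof. by move/M_label; case. Qed.

Definition cartan_root_system : root_system M V :=
  RootSystem reflection_linear h_linear M_diag cartan_label_gt1 reflection_rel
    reflection_simple a_pos h_pos reflection_pos alt_word_nonneg.

End Cartan.

(** * Root systems given by tables *)

(** The pair (a, b) stands for a + b phi, where phi is the golden ratio.  The
    coefficients of positive roots over the simple ones are of this form, with a
    and b natural. *)
Definition golden := (nat * nat)%type.

Local Notation g0 := ((0, 0)%N : golden).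
Local Notation coord v j := (nth g0 v j).

Section GoldenTables.
Local Open Scope nat_scope.

Definition gadd (x y : golden) : golden := (x.1 + y.1, x.2 + y.2).

Definition gmul (x y : golden) : golden :=
  (x.1 * y.1 + x.2 * y.2, x.1 * y.2 + x.2 * y.1 + x.2 * y.2).

(** A strict order read off from the pairs, which implies that of the real values. *)
Definition glt (x y : golden) : bool := [&& x.1 <= y.1, x.2 <= y.2 & x != y].

(** The opposite of the Cartan matrix entry of i and j.  A label 4 is the only one
    for which the two nodes get different entries, and then the product is 2. *)
Definition bond (E : diagram) (i j : nat) : golden :=
  match edge_label E i j with
  | 3 => (1, 0)
  | 4 => if i < j then (1, 0) else (2, 0)
  | 5 => (0, 1)
  | _ => (0, 0)
  end.

(** Under call-by-value evaluation, [&&] computes both of its arguments; the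
    conditional stops at the first failure, which matters in the searches below. *)
Fixpoint short_all (T : Type) (p : T -> bool) (t : seq T) : bool :=
  if t is x :: t' then if p x then short_all p t' else false else true.

Definition short_has (T : Type) (p : T -> bool) (t : seq T) : bool :=
  ~~ short_all (fun x => ~~ p x) t.

Lemma short_allE T (p : T -> bool) t : short_all p t = all p t.
Proof. by elim: t => //= x t ->. Qed.

Lemma short_hasE T (p : T -> bool) t : short_has p t = has p t.
Proof.
by rewrite /short_has short_allE -has_predC; apply: eq_has => x /=; rewrite negbK.
Qed.

Section Check.
Variables (n : nat) (E : diagram) (scalars : seq golden).
Variable chains : seq (seq (seq golden)).

Definition simple_table i : seq golden := mkseq (fun j => (nat_of_bool (i == j), 0)) n.

Definition neighbour_sum i (v : seq golden) : golden :=
  foldr (fun j t => if i == j then t else gadd (gmul (bond E i j) (coord v j)) t)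
    g0 (iota 0 n).

(** Subtraction-free form of: w is v with i-th coordinate replaced by the sum over
    the neighbours of i, minus the old coordinate. *)
Definition is_reflection i (v w : seq golden) : bool :=
  if short_all (fun j => (i == j) || (coord w j == coord v j)) (iota 0 n)
  then gadd (coord w i) (coord v i) == neighbour_sum i v else false.

(** The relation x b = y c + z d, with three scalars rather than two fractions.  The
    last clause makes d and b distinct as real vectors. *)
Definition spans (c d b : seq golden) : bool :=
  if short_has (fun x => short_has (fun y => short_has (fun z =>
      short_all (fun j =>
        gmul x (coord b j) == gadd (gmul y (coord c j)) (gmul z (coord d j)))
      (iota 0 n)) scalars) scalars) scalars
  then short_has (fun j => glt (coord d j) (coord b j) || glt (coord b j) (coord d j))
    (iota 0 n)
  else false.

(** The scalars are those needed to express b by c and d in a rank two subsystem: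
    1 if all labels are 2 or 3, also 2 for a label 4, also phi for a label 5. *)
Definition check_table : bool :=
  let roots := flatten chains in
  [&& all (fun x => x != g0) scalars,
      all (fun i => all (fun j => edge_label E i j \in [:: 2; 3; 4; 5])
        (iota 0 n)) (iota 0 n),
      all (fun v => has (fun j => coord v j != g0) (iota 0 n)) roots,
      all (fun i => simple_table i \in roots) (iota 0 n),
      all (fun i => all (fun v =>
          (v == simple_table i) || short_has (is_reflection i v) roots) roots)
        (iota 0 n)
    & all (pairwise (fun c b => short_has (fun d => spans c d b) roots)) chains].

End Check.

Definition integral (t : seq (seq (seq nat))) : seq (seq (seq golden)) :=
  map (map (map (fun x => (x, 0)))) t.

(** In each table, a root is given by its coordinates over the simple roots.  The
    chains come from a colouring of the graph in which two roots are adjacent when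
    they are the two extreme positive roots of the rank two subsystem that they
    span; sorting a colour class by height makes it a chain. *)
Definition E6_chains : seq (seq (seq golden)) := integral [::
  [:: [:: 0;0;1;0;0;0]; [:: 0;1;1;0;0;0]; [:: 0;1;2;1;0;1]; [:: 0;1;2;1;1;1];
     [:: 1;2;3;2;1;1]];
  [:: [:: 0;0;1;1;1;1]; [:: 1;1;1;1;1;1]; [:: 1;1;2;2;1;1]];
  [:: [:: 0;0;0;0;1;0]; [:: 0;0;0;1;1;0]; [:: 0;0;1;1;1;0]; [:: 0;1;1;1;1;0];
     [:: 1;1;1;1;1;0]];
  [:: [:: 1;1;1;1;0;0]; [:: 1;1;1;1;0;1]; [:: 1;2;2;1;0;1]; [:: 1;2;2;2;1;1]];
  [:: [:: 0;0;0;1;0;0]; [:: 0;0;1;1;0;0]; [:: 0;1;1;1;0;0]; [:: 0;1;2;2;1;1]];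
  [:: [:: 0;0;1;0;0;1]; [:: 0;0;1;1;0;1]; [:: 1;1;2;1;0;1]; [:: 1;2;3;2;1;2]];
  [:: [:: 0;1;0;0;0;0]; [:: 1;1;0;0;0;0]; [:: 1;2;2;1;1;1]];
  [:: [:: 0;0;0;0;0;1]; [:: 0;1;1;0;0;1]; [:: 0;1;1;1;0;1]; [:: 0;1;1;1;1;1]];
  [:: [:: 1;0;0;0;0;0]; [:: 1;1;1;0;0;0]; [:: 1;1;1;0;0;1]; [:: 1;1;2;1;1;1]]].

Definition E7_chains : seq (seq (seq golden)) := integral [::
  [:: [:: 0;1;0;0;0;0;0]; [:: 0;1;1;0;0;0;0]; [:: 0;1;1;0;0;0;1]; [:: 1;2;2;1;0;0;1];
     [:: 1;2;2;1;1;0;1]; [:: 1;2;2;1;1;1;1]; [:: 1;3;4;3;2;1;2]];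
  [:: [:: 0;0;1;0;0;0;1]; [:: 0;0;1;1;1;0;1]; [:: 0;1;2;1;1;0;1]; [:: 1;1;2;1;1;0;1];
     [:: 1;2;3;2;1;0;2]; [:: 1;2;3;2;2;1;2]; [:: 1;2;4;3;2;1;2]];
  [:: [:: 0;0;1;1;0;0;1]; [:: 0;0;1;1;1;1;1]; [:: 1;1;2;2;1;1;1]; [:: 1;2;3;2;1;1;2];
     [:: 1;2;3;3;2;1;2]];
  [:: [:: 0;0;0;1;0;0;0]; [:: 0;1;1;1;0;0;0]; [:: 0;1;1;1;0;0;1]; [:: 0;1;2;2;1;0;1];
     [:: 1;2;2;2;1;0;1]];
  [:: [:: 0;0;0;0;0;0;1]; [:: 1;1;1;0;0;0;1]; [:: 1;1;1;1;0;0;1]; [:: 1;1;1;1;1;0;1];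
     [:: 1;1;1;1;1;1;1]];
  [:: [:: 1;0;0;0;0;0;0]; [:: 1;1;0;0;0;0;0]; [:: 1;1;1;0;0;0;0]; [:: 1;1;1;1;0;0;0];
     [:: 1;1;1;1;1;0;0]; [:: 1;1;1;1;1;1;0]; [:: 2;3;4;3;2;1;2]];
  [:: [:: 0;0;0;0;1;1;0]; [:: 0;0;1;1;1;1;0]; [:: 0;1;2;1;1;1;1]; [:: 1;1;2;1;1;1;1];
     [:: 1;2;3;2;2;1;1]];
  [:: [:: 0;0;1;0;0;0;0]; [:: 0;0;1;1;0;0;0]; [:: 0;1;2;1;0;0;1]; [:: 1;1;2;1;0;0;1];
     [:: 1;2;3;2;1;0;1]; [:: 1;2;3;2;1;1;1]];
  [:: [:: 0;0;0;0;1;0;0]; [:: 0;0;0;1;1;0;0]; [:: 0;1;1;1;1;0;0]; [:: 0;1;1;1;1;0;1];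
     [:: 0;1;2;2;2;1;1]; [:: 1;2;2;2;2;1;1]];
  [:: [:: 0;0;1;1;1;0;0]; [:: 1;1;2;2;1;0;1]; [:: 1;1;2;2;2;1;1]; [:: 1;2;3;3;2;1;1]];
  [:: [:: 0;0;0;0;0;1;0]; [:: 0;0;0;1;1;1;0]; [:: 0;1;1;1;1;1;0]; [:: 0;1;1;1;1;1;1];
     [:: 0;1;2;2;1;1;1]; [:: 1;2;2;2;1;1;1]]].

Definition E8_chains : seq (seq (seq golden)) := integral [::
  [:: [:: 0;0;1;0;0;0;0;0]; [:: 0;0;1;0;0;0;0;1]; [:: 0;1;2;1;1;0;0;1];
     [:: 1;1;2;1;1;0;0;1]; [:: 1;2;4;3;2;1;1;2]; [:: 1;2;4;3;3;2;1;2];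
     [:: 2;4;6;4;3;2;1;3]];
  [:: [:: 0;0;0;0;0;1;0;0]; [:: 0;0;0;1;1;1;0;0]; [:: 0;1;1;1;1;1;0;0];
     [:: 1;1;1;1;1;1;0;0]; [:: 1;2;2;2;1;1;0;1]; [:: 1;2;2;2;2;2;1;1];
     [:: 1;2;3;3;2;2;1;1]; [:: 2;4;6;5;4;3;1;3]];
  [:: [:: 1;1;1;1;0;0;0;1]; [:: 1;1;1;1;1;0;0;1]; [:: 1;1;2;2;1;0;0;1];
     [:: 1;2;2;2;1;0;0;1]; [:: 1;2;3;2;1;0;0;2]; [:: 1;2;3;3;2;1;1;2];
     [:: 2;3;4;3;2;1;1;2]];
  [:: [:: 0;0;1;1;0;0;0;0]; [:: 1;1;1;1;0;0;0;0]; [:: 1;2;3;3;2;1;1;1];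
     [:: 2;3;5;4;3;2;1;2]];
  [:: [:: 0;0;0;0;1;1;0;0]; [:: 0;0;1;1;1;1;0;0]; [:: 0;1;2;1;1;1;0;1];
     [:: 1;1;2;1;1;1;0;1]; [:: 1;2;3;2;2;1;0;1]; [:: 1;2;3;2;2;2;1;1]];
  [:: [:: 0;0;0;0;0;0;0;1]; [:: 0;1;1;0;0;0;0;1]; [:: 1;1;1;0;0;0;0;1];
     [:: 1;2;3;2;2;1;0;2]; [:: 1;2;3;2;2;1;1;2]; [:: 1;2;3;2;2;2;1;2];
     [:: 2;4;5;4;3;2;1;3]];
  [:: [:: 0;0;0;0;1;1;1;0]; [:: 0;0;0;1;1;1;1;0]; [:: 0;0;1;1;1;1;1;0];
     [:: 0;0;1;1;1;1;1;1]; [:: 0;1;2;2;2;1;1;1]; [:: 0;1;2;2;2;2;1;1]];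
  [:: [:: 1;0;0;0;0;0;0;0]; [:: 1;1;1;1;1;1;1;1]; [:: 1;1;2;2;1;1;1;1];
     [:: 1;1;2;2;2;2;1;1]; [:: 2;3;4;3;2;2;1;2]; [:: 2;3;4;4;3;2;1;2];
     [:: 2;3;5;4;3;2;1;3]];
  [:: [:: 0;0;0;1;0;0;0;0]; [:: 0;1;2;2;1;1;0;1]; [:: 1;2;3;3;2;1;0;1];
     [:: 1;2;3;3;2;1;0;2]; [:: 1;2;4;4;3;2;1;2]; [:: 1;3;4;4;3;2;1;2];
     [:: 2;4;6;5;3;2;1;3]];
  [:: [:: 0;0;0;0;0;0;1;0]; [:: 0;0;0;0;0;1;1;0]; [:: 0;1;2;1;1;1;1;1];
     [:: 1;1;2;1;1;1;1;1]; [:: 1;2;3;2;1;1;1;1]; [:: 1;2;3;2;1;1;1;2];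
     [:: 2;4;6;5;4;3;2;3]];
  [:: [:: 1;1;1;1;1;0;0;0]; [:: 1;1;1;1;1;1;1;0]; [:: 1;2;2;2;2;1;1;1];
     [:: 1;2;3;2;2;1;1;1]; [:: 1;2;3;3;3;2;1;1]; [:: 2;3;4;3;3;2;1;2];
     [:: 2;4;5;4;3;2;1;2]];
  [:: [:: 0;1;1;0;0;0;0;0]; [:: 0;1;1;1;0;0;0;0]; [:: 1;2;3;2;1;0;0;1];
     [:: 1;3;5;4;3;2;1;2]];
  [:: [:: 0;0;1;1;1;1;0;1]; [:: 0;1;1;1;1;1;0;1]; [:: 1;1;1;1;1;1;0;1];
     [:: 1;2;3;3;2;2;1;2]; [:: 1;2;3;3;3;2;1;2]];
  [:: [:: 0;1;0;0;0;0;0;0]; [:: 0;1;1;1;1;1;1;0]; [:: 0;1;1;1;1;1;1;1];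
     [:: 1;2;2;1;1;1;1;1]; [:: 1;2;2;2;1;1;1;1]; [:: 1;3;4;3;2;1;1;2];
     [:: 1;3;4;3;2;2;1;2]];
  [:: [:: 0;0;1;1;0;0;0;1]; [:: 0;1;1;1;0;0;0;1]; [:: 0;1;2;1;0;0;0;1];
     [:: 0;1;2;2;1;0;0;1]; [:: 0;1;2;2;1;1;1;1]; [:: 1;3;5;4;3;2;1;3]];
  [:: [:: 0;1;1;1;1;0;0;0]; [:: 0;1;1;1;1;0;0;1]; [:: 0;1;2;2;2;1;0;1];
     [:: 1;2;2;2;2;1;0;1]; [:: 1;3;4;3;2;1;0;2]; [:: 1;3;4;3;3;2;1;2]];
  [:: [:: 0;0;0;0;1;0;0;0]; [:: 0;0;0;1;1;0;0;0]; [:: 0;0;1;1;1;0;0;0];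
     [:: 0;0;1;1;1;0;0;1]; [:: 1;1;2;2;2;1;0;1]; [:: 1;1;2;2;2;1;1;1];
     [:: 2;4;6;5;4;2;1;3]];
  [:: [:: 1;1;0;0;0;0;0;0]; [:: 1;1;1;0;0;0;0;0]; [:: 1;2;2;1;0;0;0;1];
     [:: 1;2;2;1;1;0;0;1]; [:: 1;2;2;1;1;1;0;1]; [:: 2;3;4;3;2;1;0;2]];
  [:: [:: 1;1;2;1;0;0;0;1]; [:: 1;1;2;2;1;1;0;1]; [:: 1;2;3;2;1;1;0;1];
     [:: 1;2;3;2;1;1;0;2]; [:: 1;2;4;3;2;1;0;2]; [:: 1;2;4;3;2;2;1;2]]].

Definition F4_chains : seq (seq (seq golden)) := integral [::
  [:: [:: 0;0;1;0]; [:: 0;1;2;0]; [:: 1;2;4;2]];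
  [:: [:: 0;1;1;0]; [:: 0;1;1;1]; [:: 0;1;2;1]; [:: 1;2;2;1]; [:: 1;2;3;1];
     [:: 1;2;3;2]; [:: 1;3;4;2]];
  [:: [:: 0;0;0;1]; [:: 0;0;1;1]; [:: 1;1;1;1]; [:: 1;1;2;1]; [:: 1;1;2;2]];
  [:: [:: 0;1;0;0]; [:: 0;1;2;2]; [:: 1;2;2;2]; [:: 2;3;4;2]];
  [:: [:: 1;0;0;0]; [:: 1;1;0;0]; [:: 1;1;1;0]; [:: 1;1;2;0]; [:: 1;2;2;0]]].

Definition H3_chains : seq (seq (seq golden)) := [::
  [:: [:: (1,0);(0,0);(0,0)]; [:: (0,1);(1,0);(0,0)]; [:: (0,1);(0,1);(0,0)];
     [:: (1,1);(1,1);(1,0)]; [:: (1,1);(1,1);(0,1)]];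
  [:: [:: (0,0);(0,0);(1,0)]; [:: (0,0);(1,0);(1,0)]; [:: (0,1);(1,0);(1,0)];
     [:: (1,0);(0,1);(0,1)]; [:: (0,1);(0,1);(0,1)]];
  [:: [:: (0,0);(1,0);(0,0)]; [:: (1,0);(0,1);(0,0)]; [:: (0,1);(1,1);(1,0)];
     [:: (0,1);(1,1);(0,1)]; [:: (1,1);(0,2);(0,1)]]].

Definition H4_chains : seq (seq (seq golden)) := [::
  [:: [:: (0,1);(0,1);(0,1);(0,0)]; [:: (0,1);(1,1);(0,1);(0,0)];
     [:: (1,1);(1,1);(1,0);(0,0)]; [:: (1,1);(1,1);(0,1);(0,0)];
     [:: (1,1);(0,2);(0,1);(0,0)]; [:: (2,2);(1,3);(1,2);(0,1)];
     [:: (1,3);(2,3);(1,2);(0,1)]];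
  [:: [:: (0,0);(0,0);(0,0);(1,0)]; [:: (0,0);(0,0);(1,0);(1,0)];
     [:: (0,0);(1,0);(1,0);(1,0)]; [:: (1,0);(0,1);(0,1);(0,1)];
     [:: (0,1);(0,1);(0,1);(0,1)]; [:: (0,1);(1,1);(0,1);(0,1)];
     [:: (0,1);(1,1);(1,1);(0,1)]; [:: (1,2);(2,2);(2,1);(1,1)];
     [:: (1,2);(2,2);(1,2);(1,1)]; [:: (1,2);(1,3);(1,2);(1,1)];
     [:: (2,3);(2,4);(1,3);(0,2)]];
  [:: [:: (0,0);(0,0);(1,0);(0,0)]; [:: (0,0);(1,0);(1,0);(0,0)];
     [:: (1,0);(0,1);(0,1);(0,0)]; [:: (0,1);(1,1);(1,1);(1,0)];
     [:: (1,1);(0,2);(0,2);(0,1)]; [:: (1,1);(1,2);(0,2);(0,1)];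
     [:: (1,2);(2,2);(2,1);(1,0)]; [:: (1,2);(2,2);(1,2);(0,1)];
     [:: (1,2);(1,3);(1,2);(0,1)]; [:: (2,2);(2,3);(2,2);(1,1)];
     [:: (2,3);(2,4);(1,3);(1,1)]];
  [:: [:: (1,0);(0,0);(0,0);(0,0)]; [:: (0,1);(1,0);(1,0);(0,0)];
     [:: (0,1);(1,0);(1,0);(1,0)]; [:: (1,1);(1,1);(1,1);(1,0)];
     [:: (1,1);(1,1);(1,1);(0,1)]; [:: (1,2);(1,2);(1,1);(1,0)];
     [:: (1,2);(1,2);(0,2);(0,1)]; [:: (2,2);(1,3);(1,2);(1,1)];
     [:: (1,3);(2,3);(2,2);(1,1)]; [:: (2,3);(3,3);(2,2);(1,1)]];
  [:: [:: (0,0);(1,0);(0,0);(0,0)]; [:: (1,0);(0,1);(0,0);(0,0)];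
     [:: (0,1);(1,1);(1,0);(0,0)]; [:: (0,1);(1,1);(1,0);(1,0)];
     [:: (1,1);(1,2);(1,1);(1,0)]; [:: (1,1);(1,2);(1,1);(0,1)];
     [:: (1,2);(2,2);(1,1);(1,0)]; [:: (1,2);(2,2);(1,1);(0,1)];
     [:: (1,2);(1,3);(0,2);(0,1)]; [:: (2,2);(2,3);(1,2);(0,1)];
     [:: (2,2);(2,3);(1,2);(1,1)]; [:: (1,3);(3,3);(2,2);(1,1)];
     [:: (2,3);(2,4);(2,2);(1,1)]];
  [:: [:: (0,1);(1,0);(0,0);(0,0)]; [:: (0,1);(0,1);(0,0);(0,0)];
     [:: (1,1);(1,1);(1,0);(1,0)]; [:: (1,1);(1,1);(0,1);(0,1)];
     [:: (1,1);(0,2);(0,1);(0,1)]; [:: (1,2);(1,2);(1,1);(0,1)];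
     [:: (2,2);(1,3);(0,2);(0,1)]; [:: (1,3);(2,3);(1,2);(1,1)]]].

Lemma check_E6 : check_table 6 (rcons (path_diagram 5) (2, 5, 3)) [:: (1, 0)] E6_chains.
Proof. by vm_compute. Qed.
Lemma check_E7 : check_table 7 (rcons (path_diagram 6) (2, 6, 3)) [:: (1, 0)] E7_chains.
Proof. by vm_compute. Qed.
Lemma check_E8 : check_table 8 (rcons (path_diagram 7) (2, 7, 3)) [:: (1, 0)] E8_chains.
Proof. by vm_compute. Qed.
Lemma check_F4 :
  check_table 4 [:: (0, 1, 3); (1, 2, 4); (2, 3, 3)] [:: (1, 0); (2, 0)] F4_chains.
Proof. by vm_compute. Qed.
Lemma check_H3 :
  check_table 3 ((0, 1, 5) :: behead (path_diagram 3)) [:: (1, 0); (0, 1)] H3_chains.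
Proof. by vm_compute. Qed.
Lemma check_H4 :
  check_table 4 ((0, 1, 5) :: behead (path_diagram 4)) [:: (1, 0); (0, 1)] H4_chains.
Proof. by vm_compute. Qed.

End GoldenTables.

(** * Bounds from the tables *)

Section GoldenValue.
Variable R : realType.

Definition phi : R := (1 + Num.sqrt 5) / 2.

Lemma phi_ge0 : 0 <= phi.
Proof. by rewrite divr_ge0 ?addr_ge0 ?sqrtr_ge0. Qed.

Lemma phi_gt0 : 0 < phi.
Proof. by have := sqrtr_ge0 (5 : R); rewrite /phi; lra. Qed.

Lemma phi_sqr : phi * phi = phi + 1.
Proof.
have := sqr_sqrtr (ler0n R 5); rewrite /phi expr2 => e; lra.
Qed.

Definition gval (x : golden) : R := x.1%:R + x.2%:R * phi.

Lemma gval_add x y : gval (gadd x y) = gval x + gval y.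
Proof. by rewrite /gval /gadd /= !natrD; ring. Qed.

Lemma gval_mul x y : gval (gmul x y) = gval x * gval y.
Proof.
rewrite /gval /gmul /= !natrD !natrM;
  move: (x.1%:R) (x.2%:R) (y.1%:R) (y.2%:R) => a b c d.
have -> : (a + b * phi) * (c + d * phi) =
    a * c + (a * d + b * c) * phi + b * d * (phi * phi) by ring.
by rewrite phi_sqr; ring.
Qed.

Lemma gval_ge0 x : 0 <= gval x.
Proof. by apply: addr_ge0; [exact: ler0n | rewrite mulr_ge0 ?ler0n ?phi_ge0]. Qed.

Lemma gval_lt x y : glt x y -> gval x < gval y.
Proof.
case: x y => a b [c d] /and3P[/= le1 le2 ne]; rewrite /gval /=.
have p0 := phi_gt0.
have [lt1|ge1] := ltnP a c.
  by apply: ltr_leD; rewrite ?ltr_nat // ler_wpM2r ?ler_nat // ltW.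
have eac : a = c by apply/eqP; rewrite eqn_leq le1 ge1.
move: ne; rewrite -eac xpair_eqE eqxx /= => ne.
by rewrite ltrD2l ltr_pM2r // ltr_nat ltn_neqAle ne.
Qed.

Lemma gval_gt0 x : x != g0 -> 0 < gval x.
Proof.
move=> x0; have -> : 0 = gval g0 by rewrite /gval mul0r addr0.
by apply: gval_lt; rewrite /glt !leq0n /= eq_sym.
Qed.

End GoldenValue.

Lemma edge_labelC E i j : edge_label E i j = edge_label E j i.
Proof. by rewrite /edge_label; under eq_filter do rewrite orbC. Qed.

Section Table.
Variables (R : realType) (n : nat) (E : diagram) (scalars : seq golden).
Variable chains : seq (seq (seq golden)).
Hypothesis checked : check_table n E scalars chains.
Local Notation V := 'rV[R]_n.
Local Notation val := (gval R).

Definition table_vec (v : seq golden) : V := \row_(j < n) val (coord v j).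
Definition table_root (i : 'I_n) : V := delta_mx 0 i.
Definition table_coroot (i : 'I_n) (v : V) : R :=
  \sum_j (if i == j then 2 else - val (bond E i j)) * v 0 j.
Definition table_height (v : V) : R := \sum_j v 0 j.
Definition table_pos : seq V := flatten (map (map table_vec) chains).

Lemma table_coroot_linear i : scalar (table_coroot i).
Proof.
move=> p x y; rewrite /table_coroot mulr_sumr -big_split /=.
by apply: eq_bigr => j _; rewrite !mxE; ring.
Qed.

Lemma table_height_linear : scalar table_height.
Proof.
move=> p x y; rewrite /table_height mulr_sumr -big_split /=.
by apply: eq_bigr => j _; rewrite !mxE.
Qed.

Lemma table_corootE i j :
  table_coroot i (table_root j) = if i == j then 2 else - val (bond E i j).
Proof.
rewrite /table_coroot (bigD1 j) //= big1 ?addr0 => [|k nkj].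
  by rewrite mxE !eqxx mulr1.
by rewrite mxE (negbTE nkj) mulr0.
Qed.

Lemma table_posP b :
  reflect (exists2 v, v \in flatten chains & b = table_vec v) (b \in table_pos).
Proof. by rewrite /table_pos -map_flatten; apply: mapP. Qed.

Lemma table_label i j : i != j ->
  dihedral_label (coxeter_matrix n E i j)
    (table_coroot i (table_root j)) (table_coroot j (table_root i)).
Proof.
move=> nij; rewrite !table_corootE (negbTE nij) eq_sym (negbTE nij) mxE (negbTE nij).
have /and5P[_ /allP lab _ _ _] := checked.
have := lab i; rewrite mem_iota ltn_ord => /(_ isT)/allP/(_ j).
rewrite mem_iota ltn_ord => /(_ isT); rewrite !inE /bond (edge_labelC _ j i).
have gE x y : val (x, y) = x%:R + y%:R * phi R by [].
have nij' : (i : nat) != j by [].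
case/or4P => /eqP ->; rewrite ?gE ?mul0r ?addr0 ?oppr0 ?mul1r ?add0r.
- exact: Label2.
- exact: Label3.
- by case: ltngtP nij' => // _ _; rewrite ?gE ?mul0r ?addr0;
    [apply: Label4l|apply: Label4r].
- by apply: Label5; [apply: phi_ge0 | apply: phi_sqr].
Qed.

Lemma mem_iota_ord (j : 'I_n) : (j : nat) \in iota 0 n.
Proof. by rewrite mem_iota ltn_ord. Qed.

Lemma table_simple_vec (i : 'I_n) : table_vec (simple_table n i) = table_root i.
Proof.
apply/rowP => j; rewrite !mxE nth_mkseq // /gval /= mul0r addr0.
by rewrite -[in RHS]val_eqE eq_sym.
Qed.

Lemma table_simple_pos i : table_root i \in table_pos.
Proof.
have /and5P[_ _ _ /allP sim _] := checked.
apply/table_posP; exists (simple_table n i); first exact/sim/mem_iota_ord.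
by rewrite table_simple_vec.
Qed.

Lemma table_height_pos b : b \in table_pos -> 0 < table_height b.
Proof.
have /and5P[_ _ /allP nz _ _] := checked.
case/table_posP => v vP ->; have /hasP[j] := nz v vP.
rewrite mem_iota /= add0n => lt_jn vj; rewrite /table_height.
rewrite (bigD1 (Ordinal lt_jn)) //= ltr_wpDr ?mxE ?gval_gt0 //.
by apply: sumr_ge0 => k _; rewrite mxE gval_ge0.
Qed.

(** The i-th coordinate is the only one that changes; there, the coroot is twice
    the coordinate minus the sum over the neighbours. *)
Lemma table_reflection (i : 'I_n) v w : is_reflection n E i v w ->
  reflection (table_coroot i) (table_root i) (table_vec v) = table_vec w.
Proof.
rewrite /is_reflection short_allE; case: ifP => // /allP same /eqP sum_wv.
apply/rowP => j; rewrite !mxE.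
case: (eqVneq j i) => [->|nji]; last first.
  have := same j (mem_iota_ord j); rewrite mulr0 subr0.
  have /negbTE -> : (i : nat) != j by rewrite eq_sym.
  by move=> /eqP ->.
have : val (neighbour_sum n E i v) =
    \sum_(j < n | i != j) val (bond E i j) * val (coord v j).
  rewrite /neighbour_sum -(big_mkord (fun j => (i : nat) != j)
    (fun j => val (bond E i j) * val (coord v j))) /index_iota subn0.
  elim: (iota 0 n) => [|k t IHt]; first by rewrite big_nil /gval mul0r addr0.
  by rewrite big_cons /=; case: ifP => // _; rewrite gval_add gval_mul IHt.
rewrite -sum_wv gval_add => e.
rewrite /table_coroot (bigD1 i) //= eqxx mxE.
rewrite (eq_bigr (fun j : 'I_n => - (val (bond E i j) * val (coord v j)))) => [|k nki].
  rewrite sumrN; under eq_bigl do rewrite eq_sym.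
  by rewrite -e; ring.
by rewrite eq_sym (negbTE nki) mxE mulNr.
Qed.

Lemma table_reflection_pos i b : b \in table_pos -> b != table_root i ->
  reflection (table_coroot i) (table_root i) b \in table_pos.
Proof.
have /and5P[_ _ _ _ /andP[/allP refl _]] := checked.
case/table_posP => v vP -> ne.
have /allP/(_ v vP) := refl i (mem_iota_ord i).
case: eqP => [ev|_ /=]; first by rewrite ev table_simple_vec eqxx in ne.
rewrite short_hasE => /hasP[w wP /table_reflection ->].
by apply/table_posP; exists w.
Qed.

Lemma coxeter_matrix_diag i : coxeter_matrix n E i i = 1%N.
Proof. by rewrite mxE eqxx. Qed.

Lemma table_coroot_diag i : table_coroot i (table_root i) = 2.
Proof. by rewrite table_corootE eqxx. Qed.

Definition table_root_system : root_system (coxeter_matrix n E) V :=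
  cartan_root_system table_coroot_linear table_coroot_diag coxeter_matrix_diag
    table_label table_height_linear table_simple_pos
    table_height_pos table_reflection_pos.

Lemma spans_precedes c d b : d \in flatten chains -> spans n scalars c d b ->
  precedes table_root_system (table_vec c) (table_vec b).
Proof.
have /and5P[/allP sc _ _ _ _] := checked.
move=> dP; rewrite /spans !short_hasE; case: ifP => // /hasP[x xs].
rewrite !short_hasE => /hasP[y ys]; rewrite short_hasE => /hasP[z zs].
rewrite short_allE => /allP eqs /hasP[j]; rewrite mem_iota /= add0n => lt_jn lt_dbj.
have x0 := gval_gt0 R (sc x xs).
exists (table_vec d), (val y / val x), (val z / val x); split.
- by apply/table_posP; exists d.
- apply: contraTneq lt_dbj => /rowP/(_ (Ordinal lt_jn)); rewrite !mxE /= => e.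
  by apply/norP; split; apply/negP => /(gval_lt R); rewrite e ltxx.
- by rewrite divr_ge0 ?gval_ge0.
- by rewrite divr_ge0 ?gval_ge0.
- apply/rowP => k; rewrite !mxE; apply: (mulfI (lt0r_neq0 x0)).
  have /eqP := eqs k (mem_iota_ord k).
  move=> /(congr1 val); rewrite gval_add !gval_mul => ->.
  by have := lt0r_neq0 x0 => ?; field.
Qed.

Theorem table_bounds (W : coxeterSystem (coxeter_matrix n E)) :
  (n <= order_dim R (weak_order W) <= size chains)%N.
Proof.
rewrite (rank_le_order_dim table_root_system) /=.
have /and5P[_ _ _ _ /andP[_ /allP ch]] := checked.
rewrite -(size_map (map table_vec));
  apply: (@order_dim_le_chains _ _ _ _ table_root_system) => //.
move=> _ /mapP[C CP ->] k l /andP[lt_kl]; rewrite size_map => lt_l.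
have lt_k := ltn_trans lt_kl lt_l.
have := ch C CP => /(pairwiseP [::]) /(_ k l lt_k lt_l lt_kl).
rewrite short_hasE => /hasP[d dP]; rewrite !(nth_map [::]) //.
exact: spans_precedes.
Qed.

End Table.

(** * Types A, B and D *)

(** The root d differs from c + d because c, being of positive height, is nonzero. *)
Lemma precedes_add (R : realType) (n : nat) (M : 'M[nat]_n) (V : lmodType R)
    (S : root_system M V) (c d b : V) :
  c \in pos_roots S -> d \in pos_roots S -> b = c + d -> precedes S c b.
Proof.
move=> cP dP ->; exists d, 1, 1; rewrite !scale1r; split=> //.
rewrite eq_sym -subr_eq0 addrK; apply: contraTneq (height_pos cP) => ->.
by have := height_linear S 1 0 0; rewrite scaler0 addr0 => e; lra.
Qed.

Lemma is_chain_pairwise (R : realType) (n : nat) (M : 'M[nat]_n) (V : lmodType R)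
    (S : root_system M V) (C : seq V) :
  pairwise (fun c b => `[< precedes S c b >]) C -> is_chain S C.
Proof.
move/(pairwiseP 0) => pw k l /andP[lt_kl lt_l]; apply/asboolP/pw => //.
exact: ltn_trans lt_l.
Qed.

Definition edge_matches (i j : nat) (e : nat * nat * nat) : bool :=
  (e.1 == (i, j)) || (e.1 == (j, i)).

(** The first matching edge decides the label, so the last edge of a diagram counts
    only if no earlier edge matches. *)
Lemma edge_label_rcons E e i j : edge_label (rcons E e) i j =
  if has (edge_matches i j) E then edge_label E i j
  else if edge_matches i j e then e.2 else 2%N.
Proof.
rewrite /edge_label filter_rcons; rewrite has_filter -/(edge_matches i j).
case: (filter _ E) => [|x t] /=; last by case: ifP; rewrite ?map_rcons.
by rewrite /edge_matches; case: ifP.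
Qed.

Lemma has_path_diagram k i j : has (edge_matches i j) (path_diagram k) =
  (maxn i j < k)%N && ((j == i.+1) || (i == j.+1)).
Proof.
rewrite /path_diagram has_map; apply/hasP/idP => [[m]|].
  by rewrite mem_iota /edge_matches /= !xpair_eqE; lia.
move=> /andP[lt_k adj]; exists (minn i j);
  rewrite ?mem_iota /edge_matches /= ?xpair_eqE; lia.
Qed.

Lemma edge_label_path k i j : edge_label (path_diagram k) i j =
  if (maxn i j < k)%N && ((j == i.+1) || (i == j.+1)) then 3%N else 2%N.
Proof.
rewrite -has_path_diagram has_filter /edge_label /edge_matches.
set t := filter _ _; have : {subset t <= path_diagram k}.
  by move=> x; rewrite mem_filter => /andP[].
case: t => //= x t sub; have := sub x (mem_head _ _).
by case/mapP => m _ ->.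
Qed.

Lemma reflectionD (R : comPzRingType) (V : lmodType R) (c : V -> R) (a x y : V) :
  scalar c -> reflection c a (x + y) = reflection c a x + reflection c a y.
Proof. by move=> cL; have := linear_reflection a cL 1 x y; rewrite !scale1r. Qed.

Lemma reflectionB (R : comPzRingType) (V : lmodType R) (c : V -> R) (a x y : V) :
  scalar c -> reflection c a (x - y) = reflection c a x - reflection c a y.
Proof.
by move=> cL; rewrite addrC -scaleN1r linear_reflection // scaleN1r addrC.
Qed.

Section Classical.
Variable R : realType.
Local Notation V := {poly R}.
Local Notation e k := ('X^k : V).

(** The effect on indices of the reflection in e_i - e_(i+1). *)
Definition swap i k : nat := if k == i then i.+1 else if k == i.+1 then i else k.

Definition coord_diff i (v : V) : R := v`_i - v`_i.+1.

Lemma coord_diff_linear i : scalar (coord_diff i).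
Proof. by move=> p x y; rewrite /coord_diff !coefD !coefZ; ring. Qed.

Lemma reflection_swap i k :
  reflection (coord_diff i) (e i - e i.+1) (e k) = e (swap i k).
Proof.
rewrite /reflection /coord_diff !coefXn /swap ![_ == k]eq_sym.
case: (eqVneq k i) => [->|nki].
  by rewrite (ltn_eqF (ltnSn i)) subr0 scale1r opprB addrC subrK.
case: (eqVneq k i.+1) => [->|nkSi]; last by rewrite subrr scale0r subr0.
by rewrite sub0r scaleN1r opprK addrC subrK.
Qed.

(** A form decreasing along the basis and positive on it: its values on e_0, ...,
    e_(N-1) are N, ..., 1. *)
Definition coord_height N (v : V) : R := \sum_(k < N) (N - k)%:R * v`_k.

Lemma coord_height_linear N : scalar (coord_height N).
Proof.
move=> p x y; rewrite /coord_height mulr_sumr -big_split /=.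
by apply: eq_bigr => j _; rewrite coefD coefZ; ring.
Qed.

Lemma coord_heightX N k : (k < N)%N -> coord_height N (e k) = (N - k)%:R.
Proof.
move=> lt_k; rewrite /coord_height (bigD1 (Ordinal lt_k)) //= big1 ?addr0 => [|j nj].
  by rewrite coefXn eqxx mulr1.
by rewrite coefXn -val_eqE /= in nj *; rewrite (negbTE nj) mulr0.
Qed.

(** Types A, B and D share the roots e_a - e_b; the flag [short] adds the e_a, and
    [signed] adds the e_a + e_b.  The basis vector e_k is the monomial 'X^k, so the
    ambient space does not depend on the number N of coordinates. *)
Inductive classical_root N (short signed : bool) : V -> Prop :=
| DiffRoot a b of (a < b < N)%N : classical_root N short signed (e a - e b)
| ShortRoot a of short & (a < N)%N : classical_root N short signed (e a)
| SumRoot a b of signed & (a < b < N)%N : classical_root N short signed (e a + e b).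

(** Sorted by height: that of e_a - e_b grows with b, that of e_a is larger, and that
    of e_b + e_a grows as b decreases to 0. *)
Definition classical_chain N (short signed : bool) a : seq V :=
  [seq e a - e b | b <- iota a.+1 (N - a.+1)] ++ nseq short (e a) ++
  [seq e b + e a | b <- rev (iota 0 (if signed then a else 0))].

Definition classical_chains n N short signed : seq (seq V) :=
  [seq classical_chain N short signed a | a <- iota 0 n].

(** In type A the last index a = N - 1 contributes an empty chain, hence there are
    n = N - 1 chains; otherwise it contributes e_a or the e_b + e_a, and n = N. *)
Lemma classical_posP n N short signed v : (n <= N)%N -> (N <= n.+1)%N ->
  (short || signed -> n = N) ->
  reflect (classical_root N short signed v)
    (v \in flatten (classical_chains n N short signed)).
Proof.
move=> le_nN le_Nn ss; apply: (iffP flatten_mapP) => [[a]|].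
  rewrite mem_iota => lt_a; rewrite !mem_cat => /or3P[/mapP[b]|/nseqP[-> sh]|/mapP[b]].
  - by rewrite mem_iota => lt_b ->; apply: DiffRoot; lia.
  - by apply: ShortRoot; lia.
  - rewrite mem_rev mem_iota; case: ifP => // sg lt_b ->.
    by apply: SumRoot => //; lia.
case=> [a b ab|a sh aN|a b sg ab].
- exists a; first by rewrite mem_iota; lia.
  rewrite !mem_cat; apply/or3P/Or31/mapP; exists b => //; rewrite mem_iota; lia.
- exists a; first by rewrite mem_iota; lia.
  by rewrite !mem_cat sh mem_seq1 eqxx orbT.
- exists b; first by rewrite mem_iota; lia.
  rewrite !mem_cat; apply/or3P/Or33/mapP; exists a => //.
  by rewrite mem_rev mem_iota sg; lia.
Qed.

Lemma classical_height_pos N short signed v :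
  classical_root N short signed v -> 0 < coord_height N v.
Proof.
have hD (x y : V) : coord_height N (x + y) = coord_height N x + coord_height N y.
  by have := coord_height_linear N 1 x y; rewrite scale1r mul1r.
have hN (x : V) : coord_height N (- x) = - coord_height N x.
  have := hD x (- x); rewrite subrr /coord_height big1 => [|k _];
    last by rewrite coef0 mulr0.
  by move=> e0; lra.
case=> [a b ab|a _ aN|a b _ ab]; rewrite ?hD ?hN !coord_heightX; try lia.
- by rewrite subr_gt0 ltr_nat; lia.
- by rewrite ltr0n subn_gt0.
- by rewrite -natrD ltr0n; lia.
Qed.

Lemma swap_root N short signed i v : (i.+1 < N)%N ->
  classical_root N short signed v -> v != e i - e i.+1 ->
  classical_root N short signed (reflection (coord_diff i) (e i - e i.+1) v).
Proof.
move=> lt_i; have cL := coord_diff_linear i.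
case=> [a b ab ne|a sh aN _|a b sg ab _].
- rewrite reflectionB // !reflection_swap.
  have nab : ~~ ((a == i) && (b == i.+1)).
    by apply: contra ne => /andP[/eqP -> /eqP ->].
  by apply: DiffRoot; move: nab; rewrite /swap; do !case: eqP; lia.
- by rewrite reflection_swap; apply: ShortRoot => //; rewrite /swap; do !case: eqP; lia.
- rewrite reflectionD // !reflection_swap.
  have [lt|ge] := ltnP (swap i a) (swap i b).
    by apply: SumRoot => //; move: lt; rewrite /swap; do !case: eqP; lia.
  by rewrite addrC; apply: SumRoot => //; move: ge; rewrite /swap; do !case: eqP; lia.
Qed.

(** For two entries of the chain of a, the difference of the later and the earlier
    one is again a root: e_b - e_c, e_b, or e_c + e_b. *)
Lemma classical_is_chain n N short signed (M : 'M[nat]_n) (S : root_system M V) a :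
  (forall v, classical_root N short signed v -> v \in pos_roots S) ->
  (a < N)%N -> is_chain S (classical_chain N short signed a).
Proof.
move=> pos aN; apply: is_chain_pairwise.
have ltP k m : pairwise ltn (iota k m).
  by rewrite -sorted_pairwise ?iota_ltn_sorted //; apply: ltn_trans.
have inD c b : (c < b < N)%N -> e c - e b \in pos_roots S.
  by move=> h; apply/pos/DiffRoot.
have inX c : short -> (c < N)%N -> e c \in pos_roots S.
  by move=> h1 h2; apply/pos/ShortRoot.
have inS c b : signed -> (c < b < N)%N -> e c + e b \in pos_roots S.
  by move=> h1 h2; apply/pos/SumRoot.
have mul2 (x y z : V) : z + x = x - y + (z + y) by ring.
rewrite /classical_chain; rewrite !pairwise_cat !pairwise_map; apply/and5P; split.
- apply/allrelP => x y /mapP[b]; rewrite mem_iota => b_gt -> {x}.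
  rewrite mem_cat => /orP[/nseqP[-> sh]|/mapP[c]].
    have sh1 : short by move: sh; rewrite lt0b.
    by apply/asboolP/(precedes_add (d := e b)); rewrite ?inD ?inX ?subrK //; lia.
  rewrite mem_rev mem_iota; case: ifP => // sg c_lt ->.
  by apply/asboolP/(precedes_add (d := e c + e b)); rewrite ?inD ?inS //; lia.
- apply: (sub_in_pairwise _ (allss _) (ltP _ _)) => b c.
  rewrite !mem_iota => b_gt c_gt lt_bc; apply/asboolP.
  by apply: (precedes_add (d := e b - e c)); rewrite ?inD //; first [lia | ring].
- apply/allrelP => x y /nseqP[-> sh] /mapP[b]; rewrite mem_rev mem_iota.
  have sh1 : short by move: sh; rewrite lt0b.
  case: ifP => // sg b_lt ->; apply/asboolP.
  by apply: (precedes_add (d := e b)); rewrite ?inX 1?addrC //; lia.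
- by case: (short).
- case: ifP => // sg.
  apply: (@sub_in_pairwise _ [pred b | b < a]%N gtn); first last.
  + by rewrite -sorted_pairwise ?rev_sorted ?iota_ltn_sorted // => x y z /= yx xz;
      apply: ltn_trans xz yx.
  + by apply/allP=> b; rewrite mem_rev mem_iota.
  move=> b c; rewrite !inE => b_lt c_lt lt_bc; apply/asboolP.
  by apply: (precedes_add (d := e c - e b)); rewrite ?inD ?inS //; first [lia | ring].
Qed.

Section ClassicalSystem.
Variables (n N : nat) (M : 'M[nat]_n) (short signed : bool).
Variables (c : 'I_n -> V -> R) (a : 'I_n -> V).
Hypotheses (le_nN : (n <= N)%N) (le_Nn : (N <= n.+1)%N).
Hypothesis n_eqN : short || signed -> n = N.
Hypothesis c_linear : forall i, scalar (c i).
Hypothesis c_diag : forall i, c i (a i) = 2.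
Hypothesis M_diag : forall i, M i i = 1%N.
Hypothesis M_label : forall i j, i != j ->
  dihedral_label (M i j) (c i (a j)) (c j (a i)).
Hypothesis a_root : forall i, classical_root N short signed (a i).
Hypothesis reflection_root : forall i v, classical_root N short signed v ->
  v != a i -> classical_root N short signed (reflection (c i) (a i) v).

Local Notation Phi := (flatten (classical_chains n N short signed)).

(** The number of chains is the rank, so that the two bounds meet. *)
Lemma classical_order_dim (W : coxeterSystem M) : order_dim R (weak_order W) = n.
Proof.
have posP v := classical_posP v le_nN le_Nn n_eqN.
have a_pos i : a i \in Phi by apply/posP/a_root.
have h_pos b : b \in Phi -> 0 < coord_height N b by move/posP/classical_height_pos.
have r_pos i b : b \in Phi -> b != a i -> reflection (c i) (a i) b \in Phi.
  by move=> /posP bP ne; apply/posP/reflection_root.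
pose S := cartan_root_system c_linear c_diag M_diag M_label
  (coord_height_linear N) a_pos h_pos r_pos.
apply/eqP; rewrite eqn_leq (rank_le_order_dim S) andbT.
have := @order_dim_le_chains _ _ _ _ S W (classical_chains n N short signed) erefl.
rewrite size_map size_iota; apply=> x /mapP[k].
rewrite mem_iota => /= lt_k -> {x}; apply: classical_is_chain => [v /posP //|].
exact: leq_trans lt_k le_nN.
Qed.

End ClassicalSystem.

Lemma coord_diff_diag i : coord_diff i (e i - e i.+1) = 2.
Proof.
rewrite /coord_diff !coefB !coefXn !eqxx.
by rewrite (gtn_eqF (ltnSn i)) (ltn_eqF (ltnSn i)) /=; ring.
Qed.

Definition adjacent i j : bool := (j == i.+1) || (i == j.+1).

Lemma coord_diff_cartan (i j : nat) : i != j ->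
  coord_diff i (e j - e j.+1) = - (adjacent i j)%:R.
Proof.
move=> nij; rewrite /coord_diff !coefB !coefXn (negbTE nij) eqSS (negbTE nij).
rewrite !subr0 sub0r -opprD -natrD /adjacent [j == _]eq_sym; congr (- _%:R).
have : ~~ ((i == j.+1) && (i.+1 == j)) by lia.
by case: (i == _); case: (_ == j).
Qed.

Lemma dihedral_label_bond (b : bool) :
  dihedral_label (if b then 3 else 2) (- b%:R) (- b%:R : R).
Proof. by case: b; [apply: Label3 | rewrite oppr0; apply: Label2]. Qed.

Lemma adjacentC i j : adjacent i j = adjacent j i.
Proof. exact: orbC. Qed.

Lemma type_A_dim n (W : coxeterSystem (type_A n)) : order_dim R (weak_order W) = n.
Proof.
apply: (@classical_order_dim n n.+1 (type_A n) false false (fun i => coord_diff i)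
  (fun i => e i - e i.+1)) => //.
- by move=> i; apply: coord_diff_linear.
- by move=> i; apply: coord_diff_diag.
- by move=> i; rewrite mxE eqxx.
- move=> i j nij; rewrite mxE (negbTE nij) edge_label_path.
  rewrite gtn_max !ltn_ord /= -/(adjacent i j) !coord_diff_cartan //;
    last by rewrite eq_sym.
  by rewrite [adjacent j i]adjacentC; apply: dihedral_label_bond.
- by move=> i; apply: DiffRoot; have := ltn_ord i; lia.
- by move=> i v vP ne; apply: swap_root => //; have := ltn_ord i; lia.
Qed.

(** The coroot of the last simple root e_m of type B. *)
Definition coord_double m (v : V) : R := 2 * v`_m.

Lemma coord_double_linear m : scalar (coord_double m).
Proof. by move=> p x y; rewrite /coord_double coefD coefZ; ring. Qed.

Lemma reflection_double m k :
  reflection (coord_double m) (e m) (e k) = if k == m then - e k else e k.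
Proof.
rewrite /reflection /coord_double coefXn eq_sym; case: eqP => [->|_].
  by rewrite mulr1 scaler_nat mulr2n opprD addrA subrr sub0r.
by rewrite mulr0 scale0r subr0.
Qed.

Lemma type_B_dim n (W : coxeterSystem (type_B n)) : (2 <= n)%N ->
  order_dim R (weak_order W) = n.
Proof.
move=> n_ge2.
pose c (i : 'I_n) : V -> R := if i.+1 == n then coord_double i else coord_diff i.
pose a (i : 'I_n) : V := if i.+1 == n then e i else e i - e i.+1.
apply: (@classical_order_dim n n (type_B n) true true c a) => //.
- move=> i; rewrite /c; case: (i.+1 == n);
    [exact: coord_double_linear | exact: coord_diff_linear].
- move=> i; rewrite /c /a; case: (i.+1 == n); last exact: coord_diff_diag.
  by rewrite /coord_double coefXn eqxx mulr1.
- by move=> i; rewrite mxE eqxx.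
- move=> i j nij; rewrite mxE (negbTE nij) edge_label_rcons has_path_diagram
    edge_label_path.
  rewrite -/(adjacent i j) gtn_max /edge_matches /= !xpair_eqE.
  have nij' : (i : nat) != j by []. have nji' : (j : nat) != i by rewrite eq_sym.
  have := ltn_ord i; have := ltn_ord j; rewrite /c /a.
  case: (eqVneq i.+1 n) => [ei|ni]; case: (eqVneq j.+1 n) => [ej|nj] lt_j lt_i.
  + by move: nij'; lia.
  + have -> : (i < n.-1)%N = false by lia.
    rewrite /coord_double /coord_diff coefB !coefXn (negbTE nij') (negbTE nji') /=.
    rewrite [j.+1 == _]eq_sym !sub0r; case: (eqVneq (i : nat) j.+1) => eij.
      by rewrite ifT ?mulrN1; [apply: Label4r | lia].
    by rewrite ifF ?oppr0 ?mulr0; [apply: Label2 | lia].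
  + have -> : (j < n.-1)%N = false by lia.
    rewrite andbF /coord_double /coord_diff coefB !coefXn.
    rewrite (negbTE nij') (negbTE nji') /=.
    rewrite [i.+1 == _]eq_sym !sub0r; case: (eqVneq (j : nat) i.+1) => eij.
      by rewrite ifT ?mulrN1; [apply: Label4l | lia].
    by rewrite ifF ?oppr0 ?mulr0; [apply: Label2 | lia].
  + have -> : (i < n.-1)%N by lia. have -> : (j < n.-1)%N by lia.
    rewrite !coord_diff_cartan // [adjacent j i]adjacentC /=.
    rewrite [in X in if _ then _ else X]ifF; last by lia.
    by have := dihedral_label_bond (adjacent i j); case: (adjacent i j).
- move=> i; rewrite /a; have := ltn_ord i.
  by case: (eqVneq i.+1 n) => h lt; [apply: ShortRoot | apply: DiffRoot]; lia.
- move=> i v vP; rewrite /c /a; have := ltn_ord i.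
  case: (eqVneq i.+1 n) => [ei _|ni lt_i]; last by apply: swap_root => //; lia.
  have dL := coord_double_linear i.
  case: vP => [k l kl _|k _ kn ne|k l _ kl _].
  + have nki : k == i = false by lia.
    rewrite reflectionB // !reflection_double nki; case: eqP => _; last exact: DiffRoot.
    by rewrite opprK; apply: SumRoot.
  + rewrite reflection_double ifF; first exact: ShortRoot.
    by apply: contraNF ne => /eqP ->.
  + have nki : k == i = false by lia.
    rewrite reflectionD // !reflection_double nki; case: eqP => _; last exact: SumRoot.
    exact: DiffRoot.
Qed.

(** The coroot of the last simple root e_m + e_(m+1) of type D. *)
Definition coord_sum m (v : V) : R := v`_m + v`_m.+1.

Lemma coord_sum_linear m : scalar (coord_sum m).
Proof. by move=> p x y; rewrite /coord_sum !coefD !coefZ; ring. Qed.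

Lemma reflection_sum m k :
  reflection (coord_sum m) (e m + e m.+1) (e k) =
  if (k == m) || (k == m.+1) then - e (swap m k) else e k.
Proof.
rewrite /reflection /coord_sum !coefXn /swap ![_ == k]eq_sym.
case: (eqVneq k m) => [->|nkm] /=.
  by rewrite (ltn_eqF (ltnSn m)) addr0 scale1r opprD addrA subrr sub0r.
case: (eqVneq k m.+1) => [->|nkSm] /=; last by rewrite addr0 scale0r subr0.
by rewrite add0r scale1r opprD addrCA subrr addr0.
Qed.

Lemma type_D_dim n (W : coxeterSystem (type_D n)) : (4 <= n)%N ->
  order_dim R (weak_order W) = n.
Proof.
move=> n_ge4.
pose c (i : 'I_n) : V -> R := if i.+1 == n then coord_sum i.-1 else coord_diff i.
pose a (i : 'I_n) : V := if i.+1 == n then e i.-1 + e i.-1.+1 else e i - e i.+1.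
apply: (@classical_order_dim n n (type_D n) false true c a) => //.
- move=> i; rewrite /c; case: (i.+1 == n);
    [exact: coord_sum_linear | exact: coord_diff_linear].
- move=> i; rewrite /c /a; case: (i.+1 == n); last exact: coord_diff_diag.
  rewrite /coord_sum !coefD !coefXn !eqxx.
  by rewrite (gtn_eqF (ltnSn _)) (ltn_eqF (ltnSn _)) /=; ring.
- by move=> i; rewrite mxE eqxx.
- move=> i j nij; rewrite mxE (negbTE nij) edge_label_rcons has_path_diagram
    edge_label_path.
  rewrite -/(adjacent i j) gtn_max /edge_matches /= !xpair_eqE.
  have nij' : (i : nat) != j by []. have nji' : (j : nat) != i by rewrite eq_sym.
  have last_cartan m k : m.+2 = n -> (k < m.+1)%N ->
      coord_diff k (e m + e m.+1) = - (k.+1 == m)%:R /\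
      coord_sum m (e k - e k.+1) = - (k.+1 == m)%:R.
    move=> em lt_k; rewrite /coord_diff /coord_sum !coefD !coefN !coefXn !eqSS.
    rewrite ![m == _]eq_sym.
    have -> : (k == m.+1) = false by lia. have -> : (m.+1 == k) = false by lia.
    by split=> /=; ring.
  have := ltn_ord i; have := ltn_ord j; rewrite /c /a.
  case: (eqVneq i.+1 n) => [ei|ni]; case: (eqVneq j.+1 n) => [ej|nj] lt_j lt_i.
  + by move: nij'; lia.
  + have -> : (i < n.-1)%N = false by lia.
    have h1 : i.-1.+2 = n by lia. have h2 : (j < i.-1.+1)%N by lia.
    have [-> ->] := last_cartan _ _ h1 h2.
    rewrite /=; set b := _ || _; have -> : (j.+1 == i.-1) = b by rewrite /b; lia.
    exact: dihedral_label_bond.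
  + have -> : (j < n.-1)%N = false by lia.
    have h1 : j.-1.+2 = n by lia. have h2 : (i < j.-1.+1)%N by lia.
    have [-> ->] := last_cartan _ _ h1 h2.
    rewrite andbF /=; set b := _ || _; have -> : (i.+1 == j.-1) = b by rewrite /b; lia.
    exact: dihedral_label_bond.
  + have -> : (i < n.-1)%N by lia. have -> : (j < n.-1)%N by lia.
    rewrite !coord_diff_cartan // [adjacent j i]adjacentC /=.
    rewrite [in X in if _ then _ else X]ifF; last by lia.
    by have := dihedral_label_bond (adjacent i j); case: (adjacent i j).
- move=> i; rewrite /a; have := ltn_ord i.
  by case: (eqVneq i.+1 n) => h lt; [apply: SumRoot | apply: DiffRoot]; lia.
- move=> i v vP; rewrite /c /a; have := ltn_ord i.
  case: (eqVneq i.+1 n) => [ei _|ni lt_i]; last by apply: swap_root => //; lia.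
  have [m em] : exists m, i = m.+1 :> nat by exists i.-1; lia.
  rewrite em /=; have dL := coord_sum_linear m.
  case: vP => [k l kl _|//|k l _ kl ne].
  + rewrite reflectionB // !reflection_sum; have [k_lt|k_ge] := ltnP k m.
      have -> : (k == m) || (k == m.+1) = false by lia.
      case: ifP => [l_m|_]; last exact: DiffRoot.
      by rewrite opprK; apply: SumRoot => //; rewrite /swap; do !case: eqP; lia.
    have [-> ->] : k = m /\ l = m.+1 by lia.
    rewrite /swap !eqxx orbT (gtn_eqF (ltnSn m)) /= opprK addrC.
    by apply: DiffRoot; lia.
  + rewrite reflectionD // !reflection_sum; have [k_lt|k_ge] := ltnP k m.
      have -> : (k == m) || (k == m.+1) = false by lia.
      case: ifP => [l_m|_]; last exact: SumRoot.
      by apply: DiffRoot; rewrite /swap; do !case: eqP; lia.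
    have [ek el] : k = m /\ l = m.+1 by lia.
    by rewrite ek el eqxx in ne.
Qed.

End Classical.

(** * Dihedral groups *)

Section Dihedral.
Variable R : realType.
Local Notation V := (R^o * R^o)%type.

Definition unit_vec (x : R) : V := (cos x, sin x).

Definition mirror (t : R) (v : V) : V :=
  (cos t * v.1 + sin t * v.2, sin t * v.1 - cos t * v.2).

Definition rotate (t : R) (v : V) : V :=
  (cos t * v.1 - sin t * v.2, sin t * v.1 + cos t * v.2).

Lemma mirror_linear t : linear (mirror t).
Proof.
by move=> p [x1 x2] [y1 y2]; congr pair; rewrite /= /GRing.scale /=; ring.
Qed.

Lemma mirror_unit_vec t x : mirror t (unit_vec x) = unit_vec (t - x).
Proof. by rewrite /mirror /unit_vec /= cosB sinB. Qed.

Lemma mirror_mirror s t v : mirror s (mirror t v) = rotate (s - t) v.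
Proof. by rewrite /mirror /rotate cosB sinB; congr pair => /=; ring. Qed.

Lemma rotate0 v : rotate 0 v = v.
Proof. by case: v => x y; rewrite /rotate cos0 sin0; congr pair => /=; ring. Qed.

Lemma iter_rotate k t v : iter k (rotate t) v = rotate (k%:R * t) v.
Proof.
elim: k => [|k IHk]; first by rewrite mul0r rotate0.
by rewrite iterS IHk -[in RHS]add1n natrD mulrDl mul1r /rotate cosD sinD;
  congr pair => /=; ring.
Qed.

(** Cramer's rule for the vector of angle y in the basis of those of angles x, z. *)
Lemma unit_vec_between x y z :
  sin (z - x) *: unit_vec y = sin (z - y) *: unit_vec x + sin (y - x) *: unit_vec z.
Proof.
by rewrite !sinB /unit_vec; congr pair; rewrite /= /GRing.scale /=; ring.
Qed.

Variable m : nat.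
Hypothesis m_gt2 : (2 < m)%N.

Definition theta : R := pi / m%:R.

Lemma m_theta : m%:R * theta = pi.
Proof. by rewrite mulrC divfK // pnatr_eq0; lia. Qed.

Lemma theta_gt0 : 0 < theta.
Proof. by rewrite divr_gt0 ?pi_gt0 // ltr0n; lia. Qed.

Definition dihedral_root (k : nat) : V := unit_vec (k%:R * theta).

(** The mirror is given by the angle t such that the reflection exchanges the angles
    x and t - x: these are pi and pi - 2 theta for the roots of angles 0 and
    pi - theta. *)
Definition mirror_angle (i : 'I_2) : R := if val i == 0%N then pi else pi - 2 * theta.

Definition dihedral_simple (i : 'I_2) : V :=
  dihedral_root (if val i == 0%N then 0 else m.-1).

(** The scalar product with the unit vector that bisects the sector of the positive
    roots: on the root of angle x, its value is sin (x + theta / 2). *)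
Definition dihedral_height (v : V) : R := sin (theta / 2) * v.1 + cos (theta / 2) * v.2.

(** Between the angles of an earlier entry and of the last root lies each later
    entry, so that one root in a chain of its own serves all the others. *)
Definition dihedral_chains : seq (seq V) :=
  [:: [seq dihedral_root k | k <- iota 0 m.-1]; [:: dihedral_root m.-1]].

Lemma dihedral_posP v :
  reflect (exists2 k, (k < m)%N & v = dihedral_root k) (v \in flatten dihedral_chains).
Proof.
rewrite /= mem_cat mem_seq1; apply: (iffP orP) => [[/mapP[k]|/eqP->]|[k lt_km ->]].
- by rewrite mem_iota => lt_k ->; exists k => //; lia.
- by exists m.-1 => //; lia.
- have [->|nk] := eqVneq k m.-1; [by right|left].
  by apply/map_f; rewrite mem_iota; lia.
Qed.

Lemma dihedral_height_linear : scalar dihedral_height.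
Proof.
by move=> p [x1 x2] [y1 y2]; rewrite /dihedral_height /= /GRing.scale /=; ring.
Qed.

Lemma dihedral_matrix (i j : 'I_2) : i != j -> type_I2 m i j = m.
Proof.
by rewrite mxE; case: i => [[|[|]]] // hi; case: j => [[|[|]]].
Qed.

Lemma mirror_rel (i j : 'I_2) v :
  iter (type_I2 m i j) (mirror (mirror_angle i) \o mirror (mirror_angle j)) v = v.
Proof.
case: (eqVneq i j) => [<-|nij].
  by rewrite mxE eqxx /= mirror_mirror subrr rotate0.
rewrite dihedral_matrix // (@eq_iter _ _ (rotate (mirror_angle i - mirror_angle j)));
  last first.
  by move=> w; rewrite /= mirror_mirror.
rewrite iter_rotate; have turn : m%:R * (2 * theta) = pi *+ 2.
  by rewrite mulr2n -m_theta; ring.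
have rot_full w : rotate (pi *+ 2) w = w.
  by case: w => x y; rewrite /rotate cos2pi sin2pi; congr pair => /=; ring.
have rot_back w : rotate (- (pi *+ 2)) w = w.
  by case: w => x y; rewrite /rotate cosN sinN cos2pi sin2pi; congr pair => /=; ring.
rewrite /mirror_angle; case: i j nij => [[|[|]]] // hi [[|[|]]] // hj _ /=.
  by rewrite (_ : pi - _ = 2 * theta) ?turn //; ring.
by rewrite (_ : pi - _ - pi = - (2 * theta)) ?mulrN ?turn //; ring.
Qed.

Lemma unit_vecDpi x : unit_vec (x + pi) = - unit_vec x.
Proof. by rewrite /unit_vec cosDpi sinDpi. Qed.

Lemma mirror0_root k : (k <= m)%N ->
  mirror pi (dihedral_root k) = dihedral_root (m - k).
Proof.
by move=> le_k; rewrite mirror_unit_vec /dihedral_root natrB // mulrBl m_theta.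
Qed.

Lemma mirror1_root k : (k <= m - 2)%N ->
  mirror (pi - 2 * theta) (dihedral_root k) = dihedral_root (m - 2 - k).
Proof.
move=> le_k; rewrite mirror_unit_vec /dihedral_root -m_theta !natrB //; last by lia.
by congr unit_vec; ring.
Qed.

Lemma mirror_simple i :
  mirror (mirror_angle i) (dihedral_simple i) = - dihedral_simple i.
Proof.
rewrite /mirror_angle /dihedral_simple; case: ifP => _.
  rewrite mirror0_root // subn0 /dihedral_root m_theta mul0r.
  by rewrite -[pi]add0r unit_vecDpi.
have e : m.-1%:R * theta = - theta + pi.
  have em : m%:R = m.-1%:R + 1 :> R by rewrite natr1 prednK //; lia.
  by rewrite -m_theta em; ring.
rewrite mirror_unit_vec /dihedral_root e unit_vecDpi opprK; congr unit_vec; ring.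
Qed.

Lemma mirror_pos i b : b \in flatten dihedral_chains -> b != dihedral_simple i ->
  mirror (mirror_angle i) b \in flatten dihedral_chains.
Proof.
case/dihedral_posP => k lt_k ->; rewrite /mirror_angle /dihedral_simple.
case: ifP => _ ne; apply/dihedral_posP.
  have k0 : k != 0%N by apply: contraNneq ne => ->.
  by exists (m - k)%N; rewrite ?mirror0_root //; lia.
have km : k != m.-1 by apply: contraNneq ne => ->.
by exists (m - 2 - k)%N; rewrite ?mirror1_root //; lia.
Qed.

Lemma dihedral_height_pos b : b \in flatten dihedral_chains -> 0 < dihedral_height b.
Proof.
case/dihedral_posP => k lt_k ->; rewrite /dihedral_height /=.
have -> : sin (theta / 2) * cos (k%:R * theta) + cos (theta / 2) * sin (k%:R * theta) =
  sin (k%:R * theta + theta / 2) by rewrite sinD; ring.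
have t0 := theta_gt0; apply: sin_gt0_pi; apply/andP; split.
  by rewrite (ltr_wpDl (mulr_ge0 (ler0n _ _) (ltW t0))) // divr_gt0.
rewrite -m_theta; have : (k%:R + 1 <= m%:R :> R) by rewrite natr1 ler_nat.
by rewrite -(ler_pM2r t0); lra.
Qed.

Lemma sin_theta_gt0 k : (0 < k < m)%N -> 0 < sin (k%:R * theta).
Proof.
move=> /andP[k0 km]; have t0 := theta_gt0; apply: sin_gt0_pi.
by rewrite mulr_gt0 ?ltr0n // -m_theta ltr_pM2r // ltr_nat.
Qed.

Lemma dihedral_between k l q : (k <= l <= q)%N -> (k < q)%N -> (q - k < m)%N ->
  exists x y : R, [/\ 0 <= x, 0 <= y &
    dihedral_root l = x *: dihedral_root k + y *: dihedral_root q].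
Proof.
move=> /andP[kl lq] kq qk.
have sinB0 u v : (u <= v)%N -> (v - u < m)%N -> 0 <= sin (v%:R * theta - u%:R * theta).
  move=> le_uv lt; rewrite -mulrBl -natrB //.
  have [->|ne] := eqVneq (v - u)%N 0%N; first by rewrite mul0r sin0.
  by rewrite ltW // sin_theta_gt0 //; lia.
have s0 : 0 < sin (q%:R * theta - k%:R * theta).
  by rewrite -mulrBl -natrB ?(ltnW kq) // sin_theta_gt0 //; lia.
have := unit_vec_between (k%:R * theta) (l%:R * theta) (q%:R * theta).
rewrite -!/(dihedral_root _); set s := sin _ in s0 *; set u := sin _;
  set w := sin _ => e.
exists (u / s), (w / s); split.
- by rewrite divr_ge0 ?(ltW s0) // sinB0 //; lia.
- by rewrite divr_ge0 ?(ltW s0) // sinB0 //; lia.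
- rewrite ![_ / s]mulrC -!scalerA -scalerDr -e scalerA mulVf ?scale1r //.
  by rewrite gt_eqF.
Qed.

(** The two mirrors replace the index k of a root by m - k and by m - 2 - k. *)
Lemma dihedral_alt_word (i j : 'I_2) k : i != j -> (k < type_I2 m i j)%N ->
  foldr (fun i => mirror (mirror_angle i)) (dihedral_simple i) (alt_word i j k) =
    dihedral_root (if odd k (+) (val i == 0%N) then k else m.-1 - k)%N.
Proof.
move=> nij; rewrite dihedral_matrix //.
elim: k => [|k IHk] lt_k; first by rewrite /= /dihedral_simple; case: ifP;
  rewrite ?subn0.
rewrite /= IHk; last by lia.
have -> : mirror_angle (if odd k then i else j) =
    if odd k (+) (val i == 0%N) then pi - 2 * theta else pi.
  by move: nij; rewrite /mirror_angle; case: i {IHk} => [[|[|]]] // ?;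
    case: j => [[|[|]]] // ?;
    case: (odd k).
case: ifP => ok; rewrite ?mirror1_root ?mirror0_root; try lia.
  by rewrite addNb ok /=; congr dihedral_root; lia.
by rewrite addNb ok /=; congr dihedral_root; lia.
Qed.

Lemma dihedral_alt_word_pos (i j : 'I_2) k : i != j -> (k < type_I2 m i j)%N ->
  exists p q : R, [/\ 0 <= p, 0 <= q &
    foldr (fun i => mirror (mirror_angle i)) (dihedral_simple i) (alt_word i j k) =
      p *: dihedral_simple i + q *: dihedral_simple j].
Proof.
move=> nij lt_k; rewrite dihedral_alt_word //; rewrite dihedral_matrix // in lt_k.
set l := if _ then _ else _; have lt_l : (l < m)%N by rewrite /l; case: ifP; lia.
have h1 : (0 <= l <= m.-1)%N by lia. have h2 : (0 < m.-1)%N by lia.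
have h3 : (m.-1 - 0 < m)%N by lia.
have [p [q [p0 q0 ->]]] := dihedral_between h1 h2 h3.
clear h1 h2 h3 lt_l l lt_k.
by move: nij; rewrite /dihedral_simple; case: i => [[|[|]]] // ?;
  case: j => [[|[|]]] // ? _ /=; [exists p, q | exists q, p]; split=> //; rewrite addrC.
Qed.

Lemma dihedral_diag (i : 'I_2) : type_I2 m i i = 1%N.
Proof. by rewrite mxE eqxx. Qed.

Lemma dihedral_gt1 (i j : 'I_2) : i != j -> (1 < type_I2 m i j)%N.
Proof. by move/dihedral_matrix ->; lia. Qed.

Lemma dihedral_simple_pos i : dihedral_simple i \in flatten dihedral_chains.
Proof.
apply/dihedral_posP; exists (if val i == 0%N then 0%N else m.-1) => //.
by case: (val i == _); lia.
Qed.

Definition dihedral_root_system : root_system (type_I2 m) V :=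
  RootSystem (fun i => mirror_linear (mirror_angle i)) dihedral_height_linear
    dihedral_diag dihedral_gt1 mirror_rel mirror_simple dihedral_simple_pos
    dihedral_height_pos mirror_pos dihedral_alt_word_pos.

Lemma dihedral_is_chain C : C \in dihedral_chains -> is_chain dihedral_root_system C.
Proof.
rewrite !inE => /orP[/eqP-> k l|/eqP-> k l]; last by rewrite /= => kl; exfalso; lia.
rewrite size_map size_iota => /andP[lt_kl lt_l].
rewrite !(nth_map 0%N) ?size_iota ?nth_iota ?add0n //; try lia.
exists (dihedral_root m.-1).
have h1 : (k <= l <= m.-1)%N by lia. have h2 : (k < m.-1)%N by lia.
have h3 : (m.-1 - k < m)%N by lia.
have [p [q [p0 q0 e]]] := dihedral_between h1 h2 h3.
have dP : dihedral_root m.-1 \in pos_roots dihedral_root_system.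
  by apply/dihedral_posP; exists m.-1 => //; lia.
exists p, q; split=> //; apply/eqP => ed.
have ec : cos (m.-1%:R * theta) = cos (l%:R * theta) := congr1 fst ed.
have es : sin (m.-1%:R * theta) = sin (l%:R * theta) := congr1 snd ed.
have lt_lm : (0 < m.-1 - l < m)%N by lia.
have := sin_theta_gt0 lt_lm; rewrite natrB; last by lia.
by rewrite mulrBl sinB ec es [X in X - _]mulrC subrr ltxx.
Qed.

Lemma dihedral_order_dim (W : coxeterSystem (type_I2 m)) :
  order_dim R (weak_order W) = 2.
Proof.
apply/eqP; rewrite eqn_leq (rank_le_order_dim dihedral_root_system) andbT.
exact: (order_dim_le_chains _ (S := dihedral_root_system) erefl dihedral_is_chain).
Qed.

End Dihedral.

Local Close Scope ring_scope.

Theorem theorem1p1 (R : realType) :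
  (forall (n : nat) (W : coxeterSystem (type_A n)),
     1 <= n -> order_dim R (weak_order W) = n) /\
  (forall (n : nat) (W : coxeterSystem (type_B n)),
     2 <= n -> order_dim R (weak_order W) = n) /\
  (forall (n : nat) (W : coxeterSystem (type_D n)),
     4 <= n -> order_dim R (weak_order W) = n) /\
  (forall W : coxeterSystem (type_E 6), 6 <= order_dim R (weak_order W) <= 9) /\
  (forall W : coxeterSystem (type_E 7), 7 <= order_dim R (weak_order W) <= 11) /\
  (forall W : coxeterSystem (type_E 8), 8 <= order_dim R (weak_order W) <= 19) /\
  (forall W : coxeterSystem type_F4, 4 <= order_dim R (weak_order W) <= 5) /\
  (forall W : coxeterSystem (type_H 3), order_dim R (weak_order W) = 3) /\
  (forall W : coxeterSystem (type_H 4), 4 <= order_dim R (weak_order W) <= 6) /\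
  (forall (m : nat) (W : coxeterSystem (type_I2 m)),
     3 <= m -> order_dim R (weak_order W) = 2).
Proof.
split=> [n W _|]; first exact: type_A_dim.
split=> [n W|]; first exact: type_B_dim.
split=> [n W|]; first exact: type_D_dim.
split=> [W|]; first exact: (table_bounds R check_E6).
split=> [W|]; first exact: (table_bounds R check_E7).
split=> [W|]; first exact: (table_bounds R check_E8).
split=> [W|]; first exact: (table_bounds R check_F4).
split=> [W|].
  by apply/eqP; rewrite eqn_leq andbC; apply: (table_bounds R check_H3).
split=> [W|m W m_gt2]; first exact: (table_bounds R check_H4).
exact: dihedral_order_dim.
Qed.
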